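(* Let $N$ be any $\mathbb{N}$-valued random variable with $\mu=\mathbb{E}[N]<\infty$ and let $X_{1},X_{2},\dots$ be a sequence of independent real-valued random variables, independent of $N$, with $\mathbb{E}[X_{i}]=0$ and $\mathbb{E}[X_{i}^{2}]=\sigma_{i}^{2}\in(0,\infty)$, $\sigma_i>0$. Set \[ \sigma^{2}=\mathbb{E}\left[\left(\sum_{i=1}^{N}X_{i}\right)^{2}\right]=\mathbb{E}\left[\sum_{i=1}^{N}\sigma_{i}^{2}\right],\qquad \sigma>0, \] and let $M$ be any $\mathbb{N}$-valued random variable, defined on the same space as $N$, with the pair $(N,M)$ independent of the $X_{i}$'s, satisfying \[ \mathbb{P}\{M=m\}=\frac{\sigma_{m}^{2}}{\sigma^{2}}\,\mathbb{P}\{N\geq m\}\qquad\text{for all } m\in\mathbb{N}. \] For each $m\in\mathbb{N}$ let $X_{m}^{L}$ be a random variable on the same probability space having the centered equilibrium distribution with respect to $X_{m}$, such that $X_m^L$ is independent of $\{X_{k}\}_{k\neq m}$, and such that $(N,M)$ is independent of the family $\{(X_i,X_i^L)\}_{i\ge1}$. Then \[ d_{BL}\left(\mathscr{L}\left(\mu^{-\frac{1}{2}}\sum_{i=1}^{N}X_{i}\right),\mathrm{Laplace}\left(0,\frac{\sigma}{\sqrt{2\mu}}\right)\right)\leq\left(\mu^{-\frac{1}{2}}+\frac{\sqrt{8}}{\sigma}\right)\left(\mathbb{E}\left|X_{M}-X_{M}^{L}\right|+\sup_{i\geq1}\sigma_{i}\;\mathbb{E}\left[|N-M|^{\frac{1}{2}}\right]\right).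 \]
   Context: $\mathbb{N}=\{1,2,3,\dots\}$. $\mathscr{L}(X)$ denotes the distribution (law) of $X$. For $b>0$, $\mathrm{Laplace}(0,b)$ is the probability distribution on $\mathbb{R}$ with density $w\mapsto\frac{1}{2b}e^{-|w|/b}$. The displayed condition on $M$ presupposes $\sigma^2<\infty$. $X_M$ and $X_M^L$ denote the random variables equal to $X_m$ and $X_m^L$, respectively, on the event $\{M=m\}$. The bounded Lipschitz distance is $d_{BL}(\mathscr{L}(X),\mathscr{L}(Y))=\sup_{h\in\mathcal{H}_{BL}}|\mathbb{E}[h(X)]-\mathbb{E}[h(Y)]|$, where $\mathcal{H}_{BL}$ is the set of $h:\mathbb{R}\to\mathbb{R}$ with $\|h\|_{\infty}\leq1$ and $|h(x)-h(y)|\leq|x-y|$ for all $x,y\in\mathbb{R}$. For a nondegenerate random variable $X$ with mean zero and finite variance, a random variable $X^{L}$ is said to have the centered equilibrium distribution with respect to $X$ if $\mathbb{E}[f(X)]-f(0)=\frac{1}{2}\mathbb{E}[X^{2}]\,\mathbb{E}[f''(X^{L})]$ for all twice-differentiable functions $f:\mathbb{R}\to\mathbb{R}$ such that $f$, $f'$ and $f''$ are bounded. *)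

(* Defs.v *)
From HB Require Import structures.
From mathcomp Require Import all_boot all_order all_algebra.
From mathcomp Require Import all_classical all_reals all_analysis.
From mathcomp Require Import measurable_realfun.

Set Implicit Arguments.
Unset Strict Implicit.
Unset Printing Implicit Defensive.

Import Order.TTheory GRing.Theory Num.Theory.
Import numFieldNormedType.Exports.

Local Open Scope ring_scope.
Local Open Scope classical_set_scope.
Local Open Scope ereal_scope.

Section independence.
Context d (T : measurableType d) (R : realType) (P : probability T R).

Definition indep_classes (F G : set (set T)) : Prop :=
  forall A B, F A -> G B -> P (A `&` B) = P A * P B.

Definition sigma_family (I : Type) d' (T' : measurableType d') (D : set I)
    (X : I -> T -> T') : set (set T) :=
  <<s \bigcup_(i in D) g_sigma_algebra_preimage (X i) >>.

Definition mutually_independent (I : choiceType) d' (T' : measurableType d')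
    (D : set I) (X : I -> T -> T') : Prop :=
  forall (J : seq I) (A : I -> set T'), uniq J ->
    (forall i, i \in J -> D i /\ measurable (A i)) ->
    P (\bigcap_(i in [set` J]) X i @^-1` A i) =
    \prod_(i <- J) P (X i @^-1` A i).

End independence.

Section laplace.
Context {R : realType}.
Local Notation mu := lebesgue_measure.

(* As for the library's [normal_pdf], degenerate parameters ([b <= 0]) get a
   dummy density so that [laplace_prob b] is a probability for every [b]. *)
Definition laplace_pdf (b w : R) : R :=
  if (0 < b)%R then ((2 * b)^-1 * expR (- (`|w| / b)))%R else \1_`[0%R, 1%R] w.

Definition laplace_prob (b : R) : set R -> \bar R :=
  fun V => \int[mu]_(x in V) (laplace_pdf b x)%:E.

Lemma laplace_pdf_ge0 b w : (0 <= laplace_pdf b w)%R.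
Proof.
rewrite /laplace_pdf; case: ifPn => // b0.
by rewrite mulr_ge0 ?expR_ge0// invr_ge0 mulr_ge0// ltW.
Qed.

Lemma continuous_laplace_pdf b : (0 < b)%R -> continuous (laplace_pdf b).
Proof.
move=> b0; rewrite /laplace_pdf b0 => x.
apply: (@cvgMr _ _ _ _ (fun w : R => expR (- (`|w| / b))) _ (expR (- (`|x| / b)))).
apply: (cvg_comp _ expR); last exact: continuous_expR.
apply: (@cvgN _ R^o); apply: cvgM; last exact: cvg_cst.
exact: (@norm_continuous _ R^o).
Qed.

Lemma measurable_laplace_pdf b : measurable_fun [set: R] (laplace_pdf b).
Proof.
have [b0|b0] := boolP (0 < b)%R.
  by apply: continuous_measurable_fun; exact: continuous_laplace_pdf.
rewrite (_ : laplace_pdf b = \1_`[0%R, 1%R]); first exact: measurable_indic.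
by apply/funext => w; rewrite /laplace_pdf (negbTE b0).
Qed.

Lemma integral_laplace_pdf b : \int[mu]_x (laplace_pdf b x)%:E = 1.
Proof.
have [b0|b0] := boolP (0 < b)%R; last first.
  under eq_integral do rewrite /laplace_pdf (negbTE b0).
  by rewrite integral_indic//= setIT lebesgue_measure_itv/= lte01 oppr0 adde0.
rewrite ge0_symfun_integralT; last first.
- by move=> x /=; rewrite /laplace_pdf b0 /= normrN.
- exact: continuous_laplace_pdf.
- exact: laplace_pdf_ge0.
have ib0 : (0 < b^-1)%R by rewrite invr_gt0.
rewrite (_ : [set x : R | (0 <= x)%R] = `[0%R, +oo[); last first.
  by apply/seteqP; split => x /=; rewrite in_itv/= andbT.
rewrite -ge0_integralZl//=; last first.
- by move=> x _; rewrite lee_fin laplace_pdf_ge0.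
- apply/measurable_EFinP; apply: measurable_funTS.
  exact: measurable_laplace_pdf.
rewrite -[RHS](integral_exponential_pdf ib0).
rewrite [RHS](_ : _ =
  \int[mu]_x ((fun x => (exponential_pdf b^-1 x)%:E) \_ `[0%R, +oo[) x); last first.
  apply: eq_integral => x _; rewrite patchE; case: ifPn => //.
  rewrite notin_setE /= in_itv/= andbT => /negP; rewrite -ltNge => x0.
  by rewrite lt0_exponential_pdf.
rewrite -integral_mkcond; apply: eq_integral => x.
rewrite inE /= in_itv/= andbT => x0.
rewrite exponential_pdfE// /laplace_pdf b0 ger0_norm// -EFinM; congr EFin.
by rewrite mulrA invfM mulrA divff// mul1r mulNr mulrC (mulrC x) mulrC.
Qed.

Section laplace_probability.
Variable b : R.

Let laplace0 : laplace_prob b set0 = 0.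
Proof. by rewrite /laplace_prob integral_set0. Qed.

Let laplace_ge0 A : 0 <= laplace_prob b A.
Proof. by apply: integral_ge0 => x _; rewrite lee_fin laplace_pdf_ge0. Qed.

Let laplace_sigma_additive : semi_sigma_additive (laplace_prob b).
Proof.
move=> /= F mF tF mUF; rewrite /laplace_prob; apply: cvg_toP.
  apply: ereal_nondecreasing_is_cvgn => m n mn.
  apply: lee_sum_nneg_natr => // k _ _; apply: integral_ge0 => /= x Fkx.
  by rewrite lee_fin laplace_pdf_ge0.
rewrite ge0_integral_bigcup//=.
- apply/measurable_funTS/measurableT_comp => //.
  exact: measurable_laplace_pdf.
- by move=> x _; rewrite lee_fin laplace_pdf_ge0.
Qed.

HB.instance Definition _ := isMeasure.Build _ _ _ (laplace_prob b)
  laplace0 laplace_ge0 laplace_sigma_additive.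

Let laplace_setT : laplace_prob b [set: _] = 1.
Proof. exact: integral_laplace_pdf. Qed.

HB.instance Definition _ :=
  @Measure_isProbability.Build _ _ R (laplace_prob b) laplace_setT.

End laplace_probability.
End laplace.

Section bounded_lipschitz_distance.
Context {R : realType}.

Definition H_BL : set (R -> R) :=
  [set h | (forall x, `|h x| <= 1)%R /\
           (forall x y, `|h x - h y| <= `|x - y|)%R].

Definition d_BL (mu nu : probability R R) : \bar R :=
  ereal_sup [set `| \int[mu]_x (h x)%:E - \int[nu]_x (h x)%:E | | h in H_BL].

End bounded_lipschitz_distance.

(* To be used for nondegenerate [X] with mean zero and finite variance. *)
Definition centered_equilibrium d (T : measurableType d) (R : realType)
    (P : probability T R) (X XL : {RV P >-> R}) : Prop :=
  forall f : R -> R,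
    (forall x, derivable f x 1%R) ->
    (forall x, derivable f^`() x 1%R) ->
    bounded_fun f -> bounded_fun f^`() -> bounded_fun f^`(2) ->
  'E_P[f \o X] - (f 0%R)%:E =
  (2^-1)%:E * 'E_P[fun w => (X w ^+ 2)%R] * 'E_P[f^`(2) \o XL].

Section random_sum.
Context d (T : measurableType d) (R : realType) (P : probability T R).
Variables (X : nat -> {RV P >-> R}) (N : {RV P >-> nat}).

(* The summation is over [i = 1, ..., N w]; [X 0] is never used. *)
Definition random_sum (w : T) : R := (\sum_(1 <= i < (N w).+1) X i w)%R.

Lemma measurable_random_sum : measurable_fun [set: T] random_sum.
Proof.
move=> _ B mB; rewrite setTI.
rewrite (_ : _ @^-1` B = \bigcup_n ((N @^-1` [set n]) `&`
   ((fun w => \sum_(1 <= i < n.+1) X i w)%R @^-1` B))); last first.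
  apply/seteqP; split => w /=.
    by move=> h; exists (N w).
  by move=> [n _ [/= <-]].
apply: bigcup_measurable => n _; apply: measurableI.
  exact: measurable_funPTI.
rewrite -[X in measurable X]setTI.
have : measurable_fun [set: T] (fun w => \sum_(1 <= i < n.+1) X i w)%R.
  exact: measurable_sum.
exact.
Qed.

HB.instance Definition _ :=
  isMeasurableFun.Build _ _ _ _ random_sum measurable_random_sum.

End random_sum.

(* Main.v *)
From HB Require Import structures.
Require Import Defs.
From mathcomp Require Import all_boot all_order all_algebra.
From mathcomp Require Import all_classical all_reals all_analysis.
From mathcomp Require Import measurable_realfun.
From mathcomp Require Import ring lra.

Set Implicit Arguments.
Unset Strict Implicit.
Unset Printing Implicit Defensive.

Import Order.TTheory GRing.Theory Num.Theory.
Import numFieldNormedType.Exports.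

Local Open Scope ring_scope.
Local Open Scope classical_set_scope.
Local Open Scope ereal_scope.

(** The proof is Stein's method.  If [W] has the law Laplace(0, b) and [h] is
bounded by 1 and 1-Lipschitz, then [g x = E (h (x + W)) - E (h W)] vanishes at
0 and solves [g - b^2 g'' = h - E (h W)].  Differentiating the Laplace density
instead of [h] gives [|g'| <= 1/b], so that [b^2 g'' = g - h + E (h W)] is
[(1 + 1/b)]-Lipschitz ([laplace_stein_exists]).  Integrating the equation at
[Y = S_N / sqrt mu], where [S_n = X_1 + ... + X_n], turns
[E (h Y) - E (h W)] into [E (g Y) - b^2 E (g'' Y)].

The term [E (g Y)] is rewritten as an expectation of a second derivative.  For
a test function [f], Fubini and the defining property of the centered
equilibrium distribution, applied to the translates of [f] by the independent
variable [S_(m-1)], give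
  [E f(S_m) - E f(S_(m-1)) = (sigma_m^2 / 2) E f''(S_(m-1) + X_m^L)].
Summing over [m <= N] and exchanging sum and expectation, each summand gets the
weight [sigma_m^2 P(N >= m) = sigma^2 P(M = m)] prescribed by the law of [M]
([size_biased]); as [(N, M)] is independent of the summands this reads
  [E f(S_N) = f 0 + (sigma^2 / 2) E f''(S_(M-1) + X_M^L)]
([random_sum_equilibrium]).  For [f x = g (x / sqrt mu)] and
[b^2 = sigma^2 / (2 mu)] the factor on the right is exactly [b^2], hence
[E (h Y) - E (h W) = b^2 E (g'' Y' - g'' Y)] with
[Y' = (S_(M-1) + X_M^L) / sqrt mu], and the Lipschitz bound leaves
[(1 + 1/b) / sqrt mu * E |S_N - S_(M-1) - X_M^L|].

Finally [S_N - S_(M-1) - X_M^L = (S_N - S_M) + (X_M - X_M^L)].  Given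
[(N, M) = (n, m)] the first part is a sum of [|n - m|] independent centered
variables, whose second moment is a sum of variances, so its first absolute
moment is at most [sup sigma_i * sqrt |n - m|] ([random_sum_gap]). *)

(** * Preliminaries on derivatives and on bounded random variables *)

Section real_functions.
Context {R : realType}.

Lemma is_derive_divr (m x : R) : is_derive x 1%R (fun y : R => y / m)%R m^-1%R.
Proof.
have := is_deriveZ m^-1%R (is_derive_id x 1%R).
rewrite (_ : (m^-1%R \*: id)%R = (fun y : R => y / m)%R); last first.
  by apply/funext => y; rewrite /GRing.scale/= mulrC.
by rewrite /GRing.scale/= mulr1.
Qed.

Lemma is_derive_continuous (f df : R -> R) :
  (forall x : R, is_derive x 1%R f (df x)) -> continuous f.
Proof.
by move=> fd x; apply/differentiable_continuous/derivable1_diffP; case: (fd x).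
Qed.

Lemma lipschitz_continuous (h : R -> R) :
  (forall x y, `|h x - h y| <= `|x - y|)%R -> continuous h.
Proof.
move=> hL x; apply/(@cvgrPdist_le _ R^o) => e e0; near=> y.
apply: le_trans (hL _ _) _; near: y.
by apply: (@cvgr_dist_le _ R^o) e0; exact: cvg_id.
Unshelve. all: by end_near. Qed.

Lemma derive_le_lipschitz (g dg : R -> R) (K : R) :
  (forall x : R, is_derive x 1%R g (dg x)) -> (forall x, `|dg x| <= K)%R ->
  forall x y, (`|g x - g y| <= K * `|x - y|)%R.
Proof.
move=> gd gK x y.
wlog xy : x y / (y <= x)%R.
  move=> H; have [|/ltW] := leP y x; first exact: H.
  by move=> /H; rewrite distrC [X in (_ <= _ * X)%R]distrC.
have [c _ ->] := @MVT_segment R g dg y x xy (fun z _ => gd z)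
  (derivable_within_continuous (fun z _ => let: DeriveDef d _ := gd z in d)).
by rewrite normrM ler_wpM2r.
Qed.

End real_functions.

Section bounded_random_variables.
Context d (T : measurableType d) (R : realType) (P : probability T R).

Lemma probability_bounded_integrable (g : T -> R) (C : R) :
  measurable_fun [set: T] g -> (forall w, `|g w| <= C)%R ->
  P.-integrable [set: T] (EFin \o g).
Proof.
move=> mg gC; apply: measurable_bounded_integrable => //.
  by apply: (le_lt_trans (probability_le1 P measurableT)); exact: ltry.
by exists C; split => [|x Cx w _]; [exact: num_real|exact: le_trans (gC w) (ltW Cx)].
Qed.

Lemma probability_integrable_cst (C : R) : P.-integrable [set: T] (EFin \o cst C).
Proof. by apply/Lfun1_integrable/Lfun_cst. Qed.

Lemma Rintegral_probability_cst (C : R) : (\int[P]_w C = C)%R.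
Proof. by rewrite Rintegral_cst// [X in fine X](probability_setT P) mulr1. Qed.

Lemma normr_expectation_le (g : T -> R) (C : R) :
  measurable_fun [set: T] g -> (forall w, `|g w| <= C)%R ->
  (`|\int[P]_w g w| <= C)%R.
Proof.
move=> mg gC; have ig := probability_bounded_integrable mg gC.
apply: le_trans (le_normr_Rintegral _ ig) _ => //.
rewrite -[leRHS]Rintegral_probability_cst; apply: le_Rintegral => //.
  exact: integrable_norm.
exact: probability_integrable_cst.
Qed.

Lemma measurable_fun_nat_comp d' (S : measurableType d') (N : {RV P >-> nat})
  (g : nat -> S) : measurable_fun [set: T] (fun w => g (N w)).
Proof.
have mN (B : set nat) : measurable (N @^-1` B) by exact: measurable_funPTI.
by move=> _ B _; rewrite setTI; exact: (mN (g @^-1` B)).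
Qed.

End bounded_random_variables.

(** * Stein's equation for the Laplace distribution *)

Section reflection.
Context {R : realType}.
Local Notation leb := (@lebesgue_measure R).

(** The substitution [y = - x] is known for nonnegative integrands; splitting
into positive and negative parts, both of which stay continuous, extends it to
every continuous integrand. *)
Lemma integral_Ny_reflect (G : R -> R) : continuous G ->
  \int[leb]_(x in `]-oo, 0%R]) (G x)%:E =
  \int[leb]_(x in `[0%R, +oo[) (G (- x)%R)%:E.
Proof.
move=> cG.
have ge0 (H : R -> R) : continuous H -> (forall x, 0 <= H x)%R ->
   \int[leb]_(x in `]-oo, 0%R]) (H x)%:E =
   \int[leb]_(x in `[0%R, +oo[) (H (- x)%R)%:E.
  move=> cH H0.
  have := @ge0_integration_by_substitutionNy R H 0%R.
  rewrite oppr0; apply => //.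
  by apply: continuous_subspaceT => x; exact: cH.
have cP : continuous (fun x => Num.max (G x) 0)%R.
  by move=> x; apply: (@continuous_max _ _ G (fun=> 0%R)); [exact: cG|exact: cst_continuous].
have cN : continuous (fun x => Num.max (- G x) 0)%R.
  move=> x; apply: (@continuous_max _ _ (fun x => - G x)%R (fun=> 0%R)); last first.
    exact: cst_continuous.
  by apply: (@continuousN _ R^o); exact: cG.
rewrite [LHS]integralE [RHS]integralE; congr (_ - _).
  transitivity (\int[leb]_(x in `]-oo, 0%R]) (Num.max (G x) 0)%:E).
    by apply: eq_integral => x _; rewrite funeposE/= EFin_max.
  rewrite ge0//; last by move=> x; rewrite le_max lexx orbT.
  by apply: eq_integral => x _; rewrite funeposE/= EFin_max.
transitivity (\int[leb]_(x in `]-oo, 0%R]) (Num.max (- G x) 0)%:E).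
  by apply: eq_integral => x _; rewrite funenegE/= EFin_max.
rewrite ge0//; last by move=> x; rewrite le_max lexx orbT.
by apply: eq_integral => x _; rewrite funenegE/= EFin_max.
Qed.

End reflection.

Section exponential_average.
Context {R : realType}.
Variable b : R.
Hypothesis b0 : (0 < b)%R.
Local Notation leb := (@lebesgue_measure R).

Lemma is_derive_expRZ (x : R) :
  is_derive x 1%R (fun y : R => expR (y / b)) (expR (x / b) / b)%R.
Proof.
have dl := is_derive_divr b x.
exact: (@is_derive1_comp R expR (fun y => y / b)%R).
Qed.

Lemma continuous_expRZ : continuous (fun y : R => expR (y / b)).
Proof. exact: is_derive_continuous is_derive_expRZ. Qed.

Lemma integral_expRZ_Ny u :
  \int[leb]_(y in `]-oo, u]) (expR (y / b))%:E = (b * expR (u / b))%:E.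
Proof.
have := @ge0_integration_by_substitutionNy R (fun y => expR (y / b)) (- u)%R.
rewrite opprK => ->; last 2 first.
- by apply: continuous_subspaceT => x; exact: continuous_expRZ.
- by move=> x _; exact: expR_ge0.
have dF (x : R) :
    is_derive x 1%R (fun y : R => - (b * expR (- y / b)))%R (expR (- x / b)).
  have d1 := @is_derive1_comp R (fun y => expR (y / b)) -%R x _ _
    (is_derive_expRZ (- x)) (is_deriveNid x 1%R).
  have := is_deriveN (is_deriveZ b d1).
  congr is_derive; rewrite /GRing.scale/=.
  by field; rewrite gt_eqF.
rewrite (@ge0_continuous_FTC2y _ _ (fun y => - (b * expR (- y / b)))%R _ 0%R)//.
- by rewrite opprK EFinN oppeK add0e.
- by move=> x _; exact: expR_ge0.
- apply: continuous_subspaceT => x; 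
  apply/differentiable_continuous/derivable1_diffP.
  by case: (@is_derive1_comp R (fun y => expR (y / b)) -%R x _ _
    (is_derive_expRZ (- x)) (is_deriveNid x 1%R)).
- rewrite -oppr0 -(mulr0 b); apply: (@cvgN _ R^o); apply: (@cvgMr _ R^o).
  rewrite (_ : (fun x => _) =
    (fun z : R => expR (- z)) \o (fun z : R => b^-1 * z)%R); last first.
    by apply/funext => x /=; rewrite mulNr mulrC.
  apply: (@cvg_comp _ _ _ _ _ _ (pinfty_nbhs R)); last exact: cvgr_expR.
  by apply: gt0_cvgMry; rewrite ?invr_gt0.
- apply/cvg_at_right_filter.
  have cF : {for (- u)%R, continuous (fun y : R => - (b * expR (- y / b)))%R}.
    by apply/differentiable_continuous/derivable1_diffP; case: (dF (- u)%R).
  exact: cF.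
- by move=> x _; rewrite derive1E; apply: derive_val.
Qed.

(** This is [b E (h (x - E_b))] for an exponential variable [E_b] of mean [b].
Written as an exponential times an integral up to [x] it can be differentiated
without differentiating [h]; the Laplace convolution of [h] is [1 / (2 b)]
times the sum of this one-sided average and its mirror image. *)
Definition left_average (h : R -> R) (x : R) : R :=
  (expR (- x / b) * \int[leb]_(y in `]-oo, x]) (expR (y / b) * h y))%R.

Lemma integrable_expRZ_Ny u :
  leb.-integrable `]-oo, u] (EFin \o (fun y : R => expR (y / b)))%R.
Proof.
apply/integrableP; split.
  apply/measurable_EFinP; apply: measurable_funTS.
  by apply: continuous_measurable_fun; exact: continuous_expRZ.
under eq_integral do rewrite /= ger0_norm ?expR_ge0//.
by rewrite integral_expRZ_Ny ltry.
Qed.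

Section bounded_continuous.
Variable h : R -> R.
Hypotheses (ch : continuous h) (h1 : forall x, (`|h x| <= 1)%R).

Lemma integrable_expRZM_Ny u :
  leb.-integrable `]-oo, u] (EFin \o (fun y : R => expR (y / b) * h y))%R.
Proof.
apply: le_integrable (integrable_expRZ_Ny u) => //.
  apply/measurable_EFinP; apply: measurable_funTS; apply: measurable_funM.
    by apply: continuous_measurable_fun; exact: continuous_expRZ.
  exact: continuous_measurable_fun.
move=> y _; rewrite /= lee_fin normrM ler_piMr//.
Qed.

Lemma left_average_le x : (`|left_average h x| <= b)%R.
Proof.
rewrite /left_average normrM ger0_norm ?expR_ge0//.
have H : (`|\int[leb]_(y in `]-oo, x]) (expR (y / b) * h y)| <= b * expR (x / b))%R.
  rewrite -lee_fin -integral_expRZ_Ny EFin_normr_Rintegral//; last exact: integrable_expRZM_Ny.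
  have ie := integrable_expRZM_Ny x.
  apply: le_trans; first by apply: le_abse_integral => //; case/integrableP: ie.
  apply: ge0_le_integral => //=.
  - by have /integrableP[+ _] := integrable_abse ie; exact.
  - by have /integrableP[+ _] := integrable_expRZ_Ny x; exact.
  - by move=> y _; rewrite lee_fin normrM ger0_norm ?expR_ge0// ler_piMr// expR_ge0.
apply: le_trans (ler_wpM2l (expR_ge0 _) H) _.
by rewrite mulrCA -expRD mulNr addNr expR0 mulr1.
Qed.

Lemma is_derive_left_average (x : R) :
  is_derive x 1%R (left_average h) (h x - left_average h x / b)%R.
Proof.
have cf : {for x, continuous (fun y : R => expR (y / b) * h y)%R}.
  by apply: continuousM; [exact: continuous_expRZ|exact: ch].
have xx1 : (x < x + 1)%R by rewrite ltrDl.
have /= FTC := continuous_FTC1 xx1 (integrable_expRZM_Ny (x + 1)%R).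
pose A x := (\int[leb]_(y in `]-oo, x]) (expR (y / b) * h y))%R.
have [d1 d2] : derivable A x 1%R /\ A^`() x = (expR (x / b) * h x)%R.
  exact: FTC (ltNyr x) cf.

have := @is_derive1_comp R (fun y => expR (y / b)) -%R x _ _
    (is_derive_expRZ (- x)) (is_deriveNid x 1%R).
have d3 : is_derive x 1%R A (expR (x / b) * h x)%R.
  apply: DeriveDef.
    exact: d1.
  by rewrite -d2 derive1E.
move=> d4; have := is_deriveM d4 d3.
congr is_derive; rewrite /GRing.scale/= /left_average -/(A x).
rewrite mulrA -expRD mulNr addNr expR0 mul1r; congr (_ + _)%R.
by ring.
Qed.
End bounded_continuous.

Definition right_average (h : R -> R) (x : R) : R := left_average (h \o -%R) (- x).

Definition laplace_average (h : R -> R) (x : R) : R :=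
  ((left_average h x + right_average h x) / (2 * b))%R.

(** Lebesgue measure and [laplace_prob] live on two copies of the measurable
space of the reals that differ only in their display.  This copy of
[laplace_prob] sits on the same one as Lebesgue measure, so that the
Radon-Nikodym theorem applies to the pair. *)
Definition laplace_borel : set (measurableTypeR R) -> \bar R := laplace_prob b.

Let laplace_borel0 : laplace_borel set0 = 0.
Proof. exact: (measure0 (laplace_prob b)). Qed.

Let laplace_borel_ge0 A : 0 <= laplace_borel A.
Proof. exact: (measure_ge0 (laplace_prob b)). Qed.

Let laplace_borel_sigma_additive : semi_sigma_additive laplace_borel.
Proof.
by move=> F mF; exact: (@measure_semi_sigma_additive _ _ _ (laplace_prob b) F mF).
Qed.

HB.instance Definition _ := isMeasure.Build _ _ _ laplace_borel
  laplace_borel0 laplace_borel_ge0 laplace_borel_sigma_additive.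

Let laplace_borel_setT : laplace_borel [set: _] = 1.
Proof. exact: (probability_setT (laplace_prob b)). Qed.

HB.instance Definition _ :=
  @Measure_isProbability.Build _ _ R laplace_borel laplace_borel_setT.

Lemma laplace_borel_dominates : laplace_borel `<< leb.
Proof.
apply/null_content_dominatesP => A mA A0; apply: null_set_integral => //.
by apply/measurable_EFinP; apply: measurable_funTS; exact: measurable_laplace_pdf.
Qed.

Lemma integral_laplace_prob (f : R -> R) :
  measurable_fun [set: R] f -> (forall x, (`|f x| <= 1)%R) ->
  \int[laplace_prob b]_x (f x)%:E = \int[leb]_x (f x * laplace_pdf b x)%:E.
Proof.
move=> mf f1.
have fi : laplace_borel.-integrable [set: measurableTypeR R] (EFin \o f).
  exact: (@probability_bounded_integrable _ _ _ laplace_borel f 1%R).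
transitivity (\int[laplace_borel]_x (f x)%:E).
  pose i : measurableTypeR R -> R := id.
  have mi : measurable_fun [set: measurableTypeR R] i by move=> _ A mA; rewrite setTI.
  transitivity (\int[pushforward laplace_borel i]_x (f x)%:E).
    by apply: eq_measure_integral.
  rewrite integral_pushforward//.
  exact/measurable_EFinP.
rewrite -(Radon_Nikodym_change_of_variables laplace_borel_dominates measurableT fi).
under [RHS]eq_integral do rewrite EFinM.
have dom := laplace_borel_dominates.
apply: ae_eq_integral => //.
- apply: emeasurable_funM; first exact/measurable_EFinP.
  apply: (measurable_int leb).
  exact: Radon_Nikodym_integrable.
- apply: emeasurable_funM; apply/measurable_EFinP => //.
  exact: measurable_laplace_pdf.
- apply: ae_eqe_mul2l.
  apply: integral_ae_eq => //.
  + exact: Radon_Nikodym_integrable.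
  + by apply/measurable_EFinP; exact: measurable_laplace_pdf.
  + by move=> E _ mE; rewrite -Radon_Nikodym_integral.
Qed.

Section stein_equation.
Variable h : R -> R.
Hypotheses (ch : continuous h) (h1 : forall x, (`|h x| <= 1)%R).

Let chN : continuous (h \o -%R).
Proof.
move=> x; apply: (@continuous_comp _ _ _ -%R h); last exact: ch.
exact: opp_continuous.
Qed.

Lemma right_average_le x : (`|right_average h x| <= b)%R.
Proof. by apply: left_average_le => // y; exact: h1. Qed.

Lemma is_derive_right_average (x : R) :
  is_derive x 1%R (right_average h) (right_average h x / b - h x)%R.
Proof.
have hN1 y : (`|(h \o -%R) y| <= 1)%R by exact: h1.
have := @is_derive1_comp R _ -%R x _ _
   (is_derive_left_average chN hN1 (- x)%R) (is_deriveNid x 1%R).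
congr is_derive; rewrite /right_average/= opprK; ring.
Qed.

Lemma laplace_average_le x : (`|laplace_average h x| <= 1)%R.
Proof.
have b20 : (0 < 2 * b)%R by rewrite mulr_gt0.
rewrite /laplace_average normrM normfV (gtr0_norm b20) ler_pdivrMr// mul1r.
apply: le_trans (ler_normD _ _) _.
rewrite mulr2n mulrDl mul1r.
by apply: lerD; [exact: left_average_le|exact: right_average_le].
Qed.

Lemma is_derive_laplace_average (x : R) :
  is_derive x 1%R (laplace_average h)
    ((right_average h x - left_average h x) / (2 * b ^+ 2))%R.
Proof.
have := is_deriveZ (2 * b)^-1%R
  (is_deriveD (is_derive_left_average ch h1 x) (is_derive_right_average x)).
have -> : ((2 * b)^-1 \*: (left_average h + right_average h))%R = laplace_average h.
  by apply/funext => y; rewrite /laplace_average [RHS]mulrC.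
congr is_derive; rewrite /GRing.scale/=.
by field; rewrite gt_eqF.
Qed.

(** Each one-sided average is at most [b] because [|h| <= 1]; this is the
smoothing effect of the convolution, the derivative falling on the density. *)
Lemma laplace_average_derive_le x :
  (`|(right_average h x - left_average h x) / (2 * b ^+ 2)| <= b^-1)%R.
Proof.
have b20 : (0 < 2 * b ^+ 2)%R by rewrite mulr_gt0// exprn_gt0.
rewrite normrM normfV (gtr0_norm b20) ler_pdivrMr//.
rewrite [leRHS](_ : _ = b + b)%R; last by field; rewrite gt_eqF.
apply: le_trans (ler_normB _ _) _.
by apply: lerD; [exact: right_average_le|exact: left_average_le].
Qed.

Lemma is_derive2_laplace_average (x : R) :
  is_derive x 1%R (fun x => (right_average h x - left_average h x) / (2 * b ^+ 2))%R
    ((laplace_average h x - h x) / b ^+ 2)%R.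
Proof.
have := is_deriveZ (2 * b ^+ 2)^-1%R
  (is_deriveB (is_derive_right_average x) (is_derive_left_average ch h1 x)).
have -> : ((2 * b ^+ 2)^-1 \*: (right_average h - left_average h))%R =
    (fun x => (right_average h x - left_average h x) / (2 * b ^+ 2))%R.
  by apply/funext => y; rewrite [RHS]mulrC.
congr is_derive; rewrite /GRing.scale/= /laplace_average.
by field; rewrite gt_eqF.
Qed.

Lemma integral_laplace : \int[laplace_prob b]_x (h x)%:E = (laplace_average h 0)%:E.
Proof.
rewrite integral_laplace_prob//; last exact: continuous_measurable_fun.
have cg : continuous (fun x => h x * laplace_pdf b x)%R.
  by move=> x; apply: continuousM; [exact: ch|exact: continuous_laplace_pdf].
have mg D : measurable_fun D (EFin \o (fun x => h x * laplace_pdf b x)%R).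
  by apply: measurable_funTS; apply/measurable_EFinP; exact: continuous_measurable_fun.
have chN' : continuous (fun x => h (- x) * laplace_pdf b x)%R.
  by move=> x; apply: continuousM; [exact: chN|exact: continuous_laplace_pdf].
have left (k : R -> R) : continuous k -> (forall x, `|k x| <= 1)%R ->
    \int[leb]_(x in `]-oo, 0%R]) (k x * laplace_pdf b x)%:E =
    (left_average k 0 / (2 * b))%:E.
  move=> ck k1; rewrite /left_average oppr0 mul0r expR0 mul1r.
  rewrite mulrC EFinM /Rintegral fineK; last first.
    by apply: integrable_fin_num => //; exact: integrable_expRZM_Ny.
  rewrite -integralZl//; last exact: integrable_expRZM_Ny.
  apply: eq_integral => x; rewrite inE/= in_itv/= => x0.
  rewrite /laplace_pdf b0 ler0_norm// -EFinM; congr EFin.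
  by rewrite mulNr opprK; ring.
rewrite -(setUv (`]-oo, 0%R]%classic : set R)) integral_setU//; last 3 first.
- exact: measurableC.
- exact: mg.
- by apply/disj_setPCl.
rewrite setCitvl.
rewrite integral_itv_obnd_cbnd; last exact: mg.
have -> : \int[leb]_(x in `[0%R, +oo[) (h x * laplace_pdf b x)%:E =
    \int[leb]_(x in `]-oo, 0%R]) (h (- x) * laplace_pdf b x)%:E.
  rewrite (integral_Ny_reflect chN').
  by apply: eq_integral => x _; rewrite opprK /laplace_pdf b0 normrN.
rewrite left// left//.
by rewrite -EFinD -mulrDl /laplace_average /right_average oppr0.
Qed.

End stein_equation.
End exponential_average.

Section stein_solution.
Context {R : realType}.

(** [c] stands for the mean of [h] under the Laplace law, and [g1], [g2] are the
first two derivatives of the solution [g]. *)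
Record laplace_stein_solution (b c : R) (h g g1 g2 : R -> R) : Prop := {
  stein_derive : forall x : R, is_derive x 1%R g (g1 x);
  stein_derive2 : forall x : R, is_derive x 1%R g1 (g2 x);
  stein_at0 : g 0%R = 0%R;
  stein_bounded : forall x, (`|g x| <= 2)%R;
  stein_derive_bounded : forall x, (`|g1 x| <= b^-1)%R;
  stein_eq : forall x, (g x - b ^+ 2 * g2 x = h x - c)%R;
  stein_lipschitz : forall x y,
    (`|b ^+ 2 * g2 x - b ^+ 2 * g2 y| <= (1 + b^-1) * `|x - y|)%R }.

(** The convolution of [h] with the Laplace density, centered by its value at 0,
which is the mean of [h]. *)
Lemma laplace_stein_exists (b : R) (h : R -> R) : (0 < b)%R -> H_BL h ->
  exists c g g1 g2, laplace_stein_solution b c h g g1 g2 /\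
    \int[laplace_prob b]_x (h x)%:E = c%:E.
Proof.
move=> b0 [h1 hL]; have ch := lipschitz_continuous hL.
exists (laplace_average b h 0), (fun x => laplace_average b h x - laplace_average b h 0)%R,
  (fun x => (right_average b h x - left_average b h x) / (2 * b ^+ 2))%R,
  (fun x => (laplace_average b h x - h x) / b ^+ 2)%R.
split; last exact: integral_laplace.
have L1 x := laplace_average_le b0 ch h1 x.
have dL x := is_derive_laplace_average b0 ch h1 x.
have dLle := laplace_average_derive_le b0 ch h1.
have bE u : (b ^+ 2 * (u / b ^+ 2) = u)%R by field; rewrite gt_eqF.
split => //.
- move=> x; have := is_deriveB (dL x) (is_derive_cst (laplace_average b h 0) x 1%R).
  by rewrite subr0.
- move=> x; exact: is_derive2_laplace_average.
- by rewrite subrr.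
- move=> x; apply: le_trans (ler_normB _ _) _.
  by rewrite (_ : 2 = 1 + 1)%R; [exact: lerD|ring].
- by move=> x; rewrite bE; ring.
- move=> x y; rewrite !bE.
  rewrite (_ : _ - _ =
    (laplace_average b h x - laplace_average b h y) - (h x - h y))%R; last by ring.
  apply: le_trans (ler_normB _ _) _.
  rewrite addrC mulrDl mul1r; apply: lerD; first exact: hL.
  exact: derive_le_lipschitz dL dLle x y.
Qed.

End stein_solution.

(** * Independence, Fubini and conditioning on a discrete index *)

(** Transporting positive and negative parts separately makes this hold for
every measurable function.  That matters inside iterated integrals, where the
inner function is integrable only almost everywhere. *)
Lemma integral_distributionT d d' (T : measurableType d) (T' : measurableType d')
    (R : realType) (P : probability T R) (X : {RV P >-> T'}) (f : T' -> \bar R) :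
  measurable_fun [set: T'] f ->
  \int[distribution P X]_y f y = \int[P]_w f (X w).
Proof.
move=> mf; rewrite [LHS]integralE [RHS]integralE.
rewrite !ge0_integral_distribution//.
- by congr (_ - _); apply: eq_integral => w _ /=; rewrite ?funeposE ?funenegE.
- exact: measurable_funeneg.
- exact: measurable_funepos.
Qed.

Section independent_fubini.
Context d d1 d2 (T : measurableType d) (T1 : measurableType d1)
  (T2 : measurableType d2) (R : realType) (P : probability T R).
Variables (X : {RV P >-> T1}) (Y : {RV P >-> T2}).
Hypothesis indepXY : indep_classes P (g_sigma_algebra_preimage X)
                                     (g_sigma_algebra_preimage Y).

Let XY w := (X w, Y w).

Let mXY : measurable_fun [set: T] XY.
Proof. exact: measurable_fun_pair. Qed.

HB.instance Definition _ := isMeasurableFun.Build _ _ _ _ XY mXY.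

(** Independence says that the joint law agrees with the product of the laws on
rectangles, and rectangles determine a measure on the product. *)
Lemma distribution_pair (A : set (T1 * T2)) : measurable A ->
  (distribution P X \x distribution P Y) A = distribution P XY A.
Proof.
move=> mA; apply: (@product_measure_unique _ _ _ _ _ _ _ (distribution P XY)) => //.
move=> B C mB mC; rewrite /distribution /pushforward.
transitivity (P (X @^-1` B `&` Y @^-1` C)) => //.
by apply: indepXY; [exists B|exists C] => //; rewrite setTI.
Qed.

Lemma ge0_indep_fubini (f : T1 * T2 -> \bar R) :
  measurable_fun [set: T1 * T2] f -> (forall z, 0 <= f z) ->
  \int[P]_w f (X w, Y w) = \int[P]_w \int[P]_v f (X w, Y v).
Proof.
move=> mf f0.
transitivity (\int[distribution P XY]_z f z).
  by rewrite ge0_integral_distribution.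
transitivity (\int[distribution P X \x distribution P Y]_z f z).
  by apply: eq_measure_integral => A mA _; exact/esym/distribution_pair.
rewrite fubini_tonelli1// ge0_integral_distribution//.
- apply: eq_integral => w _ /=; rewrite /fubini_F ge0_integral_distribution//.
  exact: measurable_fun_pair2.
- exact: measurable_fun_fubini_tonelli_F.
- by move=> x; apply: integral_ge0.
Qed.

Lemma indep_fubini (f : T1 * T2 -> \bar R) :
  measurable_fun [set: T1 * T2] f ->
  P.-integrable [set: T] (fun w => f (X w, Y w)) ->
  \int[P]_w f (X w, Y w) = \int[P]_w \int[P]_v f (X w, Y v).
Proof.
move=> mf fi.
have fiXY : (distribution P XY).-integrable [set: T1 * T2] f.
  exact: integrable_pushforward.
have fi2 : (distribution P X \x distribution P Y).-integrable [set: T1 * T2] f.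
  apply/integrableP; split => //.
  rewrite (@eq_measure_integral _ _ _ _ (distribution P XY)); last first.
    by move=> A mA _; exact: distribution_pair.
  by case/integrableP : fiXY.
transitivity (\int[distribution P XY]_z f z).
  by rewrite integral_distributionT.
transitivity (\int[distribution P X \x distribution P Y]_z f z).
  by apply: eq_measure_integral => A mA _; exact/esym/distribution_pair.
rewrite -integral12_prod_meas1// integral_distributionT; last exact: (measurable_fubini_F fi2).
apply: eq_integral => w _; rewrite /fubini_F integral_distributionT//.
exact: measurable_fun_pair2.
Qed.

End independent_fubini.

Section expectation_freezing.
Context d d1 (T : measurableType d) (T1 : measurableType d1) (R : realType)
  (P : probability T R).
Variables (code : T1 -> nat) (K : {RV P >-> T1}).
Hypothesis code_inj : injective code.
Hypothesis measurable_singleton : forall k : T1, measurable [set k].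

Let F j : set T := K @^-1` [set k | code k = j].

Let fiberE k : F (code k) = K @^-1` [set k].
Proof. by apply/seteqP; split => w /= => [/code_inj //|Kwk]; congr code. Qed.

Let fiber_empty j : ~ (exists k, code k = j) -> F j = set0.
Proof. by move=> nk; apply/seteqP; split => w //= Kw; apply: nk; exists (K w). Qed.

Let measurable_fiber k : measurable (K @^-1` [set k]).
Proof. exact: measurable_funPTI. Qed.

Let mF j : measurable (F j).
Proof.
have [[k <-]|/fiber_empty ->//] := pselect (exists k, code k = j).
by rewrite fiberE.
Qed.

Let bigcup_fiber : \bigcup_j F j = [set: T].
Proof. by apply/seteqP; split => w // _; exists (code (K w)). Qed.

Let trivIset_fiber : trivIset [set: nat] F.
Proof. by move=> i j _ _ [w [/= <- <-]]. Qed.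

Lemma measurable_fun_select d2 (S : measurableType d2) (g : T1 -> T -> S) :
  (forall k, measurable_fun [set: T] (g k)) ->
  measurable_fun [set: T] (fun w => g (K w) w).
Proof.
move=> mg; rewrite -bigcup_fiber; apply/measurable_fun_bigcup => // j.
have [[k <-]|/fiber_empty ->] := pselect (exists k, code k = j); last first.
  exact: measurable_fun_set0.
rewrite fiberE; apply: (eq_measurable_fun (g k)).
  by move=> w; rewrite inE/= => ->.
exact: measurable_funTS.
Qed.

(** If [K] takes countably many values and is independent of every [Z k], then
the index [K] may be frozen: conditionally on [K = k] the variable [Z (K w) w]
has the law of [Z k].  The fibers of [K], numbered by [code], form a countable
measurable partition, and on each of them the claim is Fubini applied to
[1_(K = k) * Z k]. *)
Lemma ge0_freezing (Z : T1 -> {RV P >-> R}) :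
  (forall k w, 0 <= Z k w)%R ->
  (forall k, indep_classes P (g_sigma_algebra_preimage K)
                             (g_sigma_algebra_preimage (Z k))) ->
  \int[P]_w (Z (K w) w)%:E = \int[P]_w \int[P]_v (Z (K w) v)%:E.
Proof.
move=> Z0 indepZ.
have mZ : measurable_fun [set: T] (fun w => (Z (K w) w)%:E).
  by apply: (@measurable_fun_select _ _ (fun k w => (Z k w)%:E)) => k; exact/measurable_EFinP.
have mEZ : measurable_fun [set: T] (fun w => \int[P]_v (Z (K w) v)%:E).
  by apply: (@measurable_fun_select _ _ (fun k w => \int[P]_v (Z k v)%:E)) => k.
rewrite -bigcup_fiber !ge0_integral_bigcup// ?bigcup_fiber//; last 2 first.
- by move=> w _; apply: integral_ge0 => v _; rewrite lee_fin.
- by move=> w _; rewrite lee_fin.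
apply: eq_eseriesr => j _.
have [[k <-]|/fiber_empty ->] := pselect (exists k, code k = j); last first.
  by rewrite !integral_set0.
rewrite fiberE.
have indic_int (f : T1 -> T -> \bar R) : 
    \int[P]_(w in K @^-1` [set k]) f (K w) w = \int[P]_w ((\1_[set k] (K w) : R)%:E * f k w).
  rewrite integral_mkcond; apply: eq_integral => w _.
  rewrite patchE indicE; case: ifPn; first by rewrite inE/= => ->; rewrite mem_set// mul1e.
  by move=> Kwk; rewrite memNset ?mul0e// => Kw; move/negP: Kwk; apply; rewrite inE.
rewrite (indic_int (fun k w => (Z k w)%:E)) (indic_int (fun k w => \int[P]_v (Z k v)%:E)).
have m1 : measurable_fun [set: T1 * R] (fun z => (\1_[set k] z.1 * `|z.2|)%:E).
  apply/measurable_EFinP; apply: measurable_funM.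
    have mi : measurable_fun [set: T1] (\1_[set k] : T1 -> R) by exact: measurable_indic.
    exact: measurableT_comp mi measurable_fst.
  by apply: measurableT_comp => //; exact: measurable_normr.
have := ge0_indep_fubini (indepZ k) m1.
rewrite /= => fub; transitivity (\int[P]_w (\1_[set k] (K w) * `|Z k w|)%:E).
  by apply: eq_integral => w _; rewrite ger0_norm.
rewrite fub; last by move=> z; rewrite lee_fin mulr_ge0 ?indicE.
apply: eq_integral => w _; rewrite -ge0_integralZl//.
- by apply: eq_integral => v _; rewrite ger0_norm.
- exact/measurable_EFinP.
- by move=> v _; rewrite lee_fin.
Qed.

(** Adding the bound [C] reduces the signed case to the nonnegative one. *)
Lemma bounded_freezing (Z : T1 -> {RV P >-> R}) (C : R) :
  (forall k w, `|Z k w| <= C)%R ->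
  (forall k, indep_classes P (g_sigma_algebra_preimage K)
                             (g_sigma_algebra_preimage (Z k))) ->
  (\int[P]_w Z (K w) w = \int[P]_w \int[P]_v Z (K w) v)%R.
Proof.
move=> ZC indepZ.
pose Z' k : {RV P >-> R} := (Z k + cst C)%R.
have Z'0 k w : (0 <= Z' k w)%R.
  by rewrite /Z'/= -lerBlDr sub0r; have := ZC k w; rewrite ler_norml => /andP[].
have indepZ' k : indep_classes P (g_sigma_algebra_preimage K)
                                 (g_sigma_algebra_preimage (Z' k)).
  move=> A B KA [D mD <-]; apply: indepZ => //.
  exists [set x | D (x + C)%R]; last by [].
  rewrite -[X in measurable X]setTI.
  by apply: (measurable_funD (@measurable_id _ R setT) (measurable_cst C)).
have mZ : measurable_fun [set: T] (fun w => Z (K w) w).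
  exact: (@measurable_fun_select _ _ (fun k w => Z k w)).
have Zi := @probability_bounded_integrable _ _ _ P _ C.
have iZ k := Zi _ (measurable_funP (Z k)) (ZC k).
have ic := probability_integrable_cst P C.
have Pc := Rintegral_probability_cst P C.
have EC k : (\int[P]_v Z' k v = \int[P]_v Z k v + C)%R by rewrite /Z'/= RintegralD// Pc.
have EC' : (\int[P]_w Z' (K w) w = \int[P]_w Z (K w) w + C)%R.
  by rewrite /Z'/= RintegralD// ?Pc//; exact: Zi.
have mEZ : measurable_fun [set: T] (fun w => \int[P]_v Z (K w) v)%R.
  exact: (@measurable_fun_select _ _ (fun k w => \int[P]_v Z k v)%R).
have EZC k : (`|\int[P]_v Z k v| <= C)%R by exact: normr_expectation_le.
apply: (@addIr _ C); rewrite -EC'.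
transitivity (\int[P]_w (\int[P]_v Z (K w) v + C))%R; last first.
  by rewrite RintegralD// ?Pc//; apply: Zi.
under [RHS]eq_Rintegral do rewrite -EC.
rewrite /Rintegral (ge0_freezing Z'0 indepZ'); congr fine; apply: eq_integral => w _.
rewrite fineK//; apply: integrable_fin_num => //.
rewrite /Z'/=; apply: (@probability_bounded_integrable _ _ _ _ _ (C + `|C|)) => //.
by move=> v; apply: le_trans (ler_normD _ _) _; rewrite lerD.
Qed.
End expectation_freezing.

(** * Independence of generated sigma-algebras *)

Section sigma_family_independence.
Context d d' (T : measurableType d) (T' : measurableType d') (R : realType)
  (P : probability T R) (I : choiceType).
Implicit Types (D : set I) (X : I -> T -> T').

Lemma sigma_family_measurable D X i : D i ->
  measurable_fun [set: g_sigma_algebraType (\bigcup_(i in D) g_sigma_algebra_preimage (X i))]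
    (X i).
Proof.
move=> Di _ B mB; apply: sub_sigma_algebra; exists i => //; by exists B.
Qed.

Lemma sub_sigma_family d2 (S : measurableType d2) D X (Z : T -> S) :
  measurable_fun
    [set: g_sigma_algebraType (\bigcup_(i in D) g_sigma_algebra_preimage (X i))] Z ->
  g_sigma_algebra_preimage Z `<=` sigma_family D X.
Proof. by move=> mZ _ [B mB <-]; exact: (mZ measurableT B mB). Qed.

Lemma sub_indep_classes (F F' G G' : set (set T)) : F' `<=` F -> G' `<=` G ->
  indep_classes P F G -> indep_classes P F' G'.
Proof. by move=> FF GG FG A B /FF FA /GG GB; exact: FG. Qed.

Lemma indep_classes_sym (F G : set (set T)) :
  indep_classes P F G -> indep_classes P G F.
Proof. by move=> FG A B GA FB; rewrite setIC FG// muleC. Qed.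

Let cylinder D X : set (set T) := [set C | exists (J : seq I) (A : I -> set T'),
  [/\ uniq J, (forall i, i \in J -> D i /\ measurable (A i)) &
      C = \bigcap_(i in [set` J]) X i @^-1` A i]].

(** Mutual independence gives the product rule only for finite intersections of
events [X i @^-1` A i].  These cylinders form a pi-system generating the
sigma-algebra of the remaining variables, so for a fixed event [X m @^-1` B]
the two finite measures [C |-> P (C `&` X m @^-1` B)] and
[C |-> P (X m @^-1` B) * P C] agree on all of it. *)
Lemma mutually_independent_sigma_family D X m :
  (forall i, measurable_fun [set: T] (X i)) ->
  mutually_independent P D X -> D m ->
  indep_classes P (g_sigma_algebra_preimage (X m))
    (sigma_family [set k | D k /\ k <> m] X).
Proof.
move=> mX indepX Dm _ E [B mB <-]; rewrite setTI => XE.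
pose D' := [set k | D k /\ k <> m].
have mXB : measurable (X m @^-1` B) by rewrite -[X in measurable X]setTI; exact: mX.
pose m1 := mrestr P mXB.
pose m2 := mscale (NngNum (fine_ge0 (measure_ge0 P (X m @^-1` B)))) P.
have m2E C : m2 C = P (X m @^-1` B) * P C.
  by rewrite /m2 /mscale/= fineK// fin_num_measure.
suff : m1 E = m2 E by rewrite m2E setIC.
have cylT : cylinder D' X [set: T].
  exists [::], (fun=> setT); split => //.
  by apply/seteqP; split => // w _ i.
apply: (@g_sigma_algebra_measure_unique _ _ _ (cylinder D' X) _ (fun=> setT)) => //.
- move=> _ [J [A [_ JA ->]]].
  apply: fin_bigcap_measurable => // i /= iJ.
  by rewrite -[X in measurable X]setTI; apply: mX => //; case: (JA i iJ).
- by apply/seteqP; split => // w _; exists 0%N.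
- move=> _ _ [J1 [A1 [u1 JA1 ->]]] [J2 [A2 [u2 JA2 ->]]].
  exists (undup (J1 ++ J2)), (fun i => (if i \in J1 then A1 i else setT) `&`
                        (if i \in J2 then A2 i else setT)).
  split; first exact: undup_uniq.
  + move=> i; rewrite mem_undup mem_cat => /orP iJ; split.
      by case: iJ => [/JA1[]|/JA2[]].
    by apply: measurableI; case: ifPn => //; [case/JA1|case/JA2].
  + apply/seteqP; split=> [w [h1 h2] i /=|w h].
      move=> _; split; case: ifPn => // iJ; [exact: h1|exact: h2].
    split=> i /= iJ.
      have [] := h i; first by rewrite /= mem_undup mem_cat iJ.
      by rewrite iJ.
    have [] := h i; first by rewrite /= mem_undup mem_cat iJ orbT.
    by rewrite iJ.
- move=> _ [J [A [uJ JA ->]]].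
  rewrite -[LHS]/(m1 _) -[RHS]/(m2 _) m2E /m1 /mrestr.
  have mJ : m \notin J by apply/negP => /JA[[_ /(_ erefl)]].
  pose A' i := if i == m then B else A i.
  have JA' i : i \in m :: J -> D i /\ measurable (A' i).
    rewrite inE /A'; case: eqP => [-> _ //|_ /= /JA[[]]//].
  have umJ : uniq (m :: J) by rewrite /= mJ.
  have := indepX (m :: J) A' umJ JA'.
  have A'm : A' m = B by rewrite /A' eqxx.
  rewrite big_cons A'm.
  have AA' i : i \in J -> A' i = A i.
    by move=> iJ; rewrite /A'; case: eqP => // im; move: mJ; rewrite -im iJ.
  have JAD i : i \in J -> D i /\ measurable (A i) by case/JA => [[]].
  rewrite (eq_big_seq (fun i => P (X i @^-1` A i))); last by move=> i iJ; rewrite AA'.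
  rewrite -(indepX J A uJ JAD) => <-; congr (P _).
  apply/seteqP; split => [w [h XmB] i /=|w h].
    rewrite inE /A'; case: eqP => [-> //|_ /= iJ]; exact: h.
  split=> [i /= iJ|].
    by rewrite -AA'//; apply: h; rewrite /= inE iJ orbT.
  by have := h m; rewrite A'm; apply; rewrite /= inE eqxx.
- move=> k; rewrite -[ltLHS]/(m1 _) /m1 /mrestr setTI.
  by apply: (le_lt_trans (probability_le1 P mXB)); exact: ltry.
- apply: sub_sigma_algebra2 XE => C [i [Di im] [A mA <-]]; rewrite setTI.
  exists [:: i], (fun=> A); split => //.
    by move=> j; rewrite inE => /eqP ->.
  apply/seteqP; split => [w XA j /=|w h]; first by rewrite inE => /eqP ->.
  by apply: (h i); rewrite /= inE.
Qed.

End sigma_family_independence.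

(** * Adding an independent variable to one with an equilibrium partner *)

Section independent_expectations.
Context d (T : measurableType d) (R : realType) (P : probability T R).

Lemma bounded_indep_fubini (S U : {RV P >-> R}) (f : R * R -> R) (C : R) :
  indep_classes P (g_sigma_algebra_preimage S) (g_sigma_algebra_preimage U) ->
  measurable_fun [set: R * R] f -> (forall z, `|f z| <= C)%R ->
  (\int[P]_w f (S w, U w) = \int[P]_w \int[P]_v f (S w, U v))%R.
Proof.
move=> indSU mf fC.
have mSU : measurable_fun [set: T] (fun w => (S w, U w)) by exact: measurable_fun_pair.
rewrite {1}/Rintegral (indep_fubini indSU (f := EFin \o f)).
- congr fine; apply: eq_integral => w _; rewrite /Rintegral fineK//.
  apply: integrable_fin_num => //.
  apply: (@probability_bounded_integrable _ _ _ _ _ C) => [|v]; last exact: fC.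
  have mSw : measurable_fun [set: T] (fun v => (S w, U v)) by exact: measurable_fun_pair.
  exact: measurableT_comp mf mSw.
- exact/measurable_EFinP.
- apply: (@probability_bounded_integrable _ _ _ _ _ C) => [|v]; last exact: fC.
  exact: measurableT_comp mf mSU.
Qed.

Lemma measurable_partial_expectation (S U : {RV P >-> R}) (f : R * R -> R) (C : R) :
  measurable_fun [set: R * R] f -> (forall z, `|f z| <= C)%R ->
  measurable_fun [set: T] (fun w => \int[P]_v f (S w, U v))%R.
Proof.
move=> mf fC.
suff mF : measurable_fun [set: R] (fun x => \int[P]_v f (x, U v))%R.
  exact: measurableT_comp mF (measurable_funP S).
pose mS := distribution P S; pose mU := distribution P U.
have fi : (mS \x mU).-integrable [set: R * R] (EFin \o f).
  apply: measurable_bounded_integrable => //.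
    have mE : (mS \x mU) [set: R * R] = 1.
      have := product_measure1E mS mU measurableT measurableT.
      rewrite setXTT => E1; apply: etrans E1 _.
      exact: etrans (congr2 mule (probability_setT mS) (probability_setT mU)) (mule1 1).
    by rewrite [ltLHS]mE ltry.
  by exists C; split => [|x Cx w _]; [exact: num_real|exact: le_trans (fC w) (ltW Cx)].
apply: (eq_measurable_fun (fun x => fine (fubini_F mU (EFin \o f) x))).
  move=> x _; rewrite /fubini_F integral_distributionT//.
  by apply/measurable_EFinP; exact: measurable_fun_pair2.
by apply: measurableT_comp => //; exact: measurable_fubini_F fi.
Qed.

(** The functions to which the equilibrium property applies, with explicit
derivatives and a common bound, so that translates stay in the class with the
same bound. *)
Record test_function (f f1 f2 : R -> R) (C : R) : Prop := {
  test_derive : forall x : R, is_derive x 1%R f (f1 x);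
  test_derive2 : forall x : R, is_derive x 1%R f1 (f2 x);
  test_measurable : measurable_fun [set: R] f2;
  test_bounded : forall x, (`|f x| <= C)%R;
  test_bounded1 : forall x, (`|f1 x| <= C)%R;
  test_bounded2 : forall x, (`|f2 x| <= C)%R }.

Lemma test_function_shift f f1 f2 C y : test_function f f1 f2 C ->
  test_function (fun x => f (y + x)%R) (fun x => f1 (y + x)%R) (fun x => f2 (y + x)%R) C.
Proof.
move=> [d1 d2 mf2 b b1 b2].
have dy (x : R) : is_derive x 1%R (fun x => y + x)%R 1%R.
  have := is_deriveD (is_derive_cst y x 1%R) (is_derive_id x 1%R).
  by rewrite add0r.
split => //.
- by move=> x; have := @is_derive1_comp R _ _ x _ _ (d1 (y + x)%R) (dy x); rewrite mulr1.
- by move=> x; have := @is_derive1_comp R _ _ x _ _ (d2 (y + x)%R) (dy x); rewrite mulr1.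
- by apply: measurableT_comp => //; exact: measurable_funD.
Qed.

Lemma equilibrium_test_function (U V : {RV P >-> R}) (v : R) f f1 f2 C :
  centered_equilibrium U V -> 'E_P[fun w => (U w ^+ 2)%R] = v%:E ->
  test_function f f1 f2 C ->
  (\int[P]_w f (U w) = f 0 + v / 2 * \int[P]_w f2 (V w))%R.
Proof.
move=> UV Uv [d1 d2 mf2 b b1 b2].
have f1E : f^`() = f1 by apply/funext => x; rewrite derive1E; exact: derive_val.
have f2E : f^`(2) = f2.
  by apply/funext => x; rewrite /derive1n/= f1E derive1E; exact: derive_val.
have bdd (g : R -> R) : (forall x, `|g x| <= C)%R -> bounded_fun g.
  move=> gC; exists C; split => [|x Cx w _]; first exact: num_real.
  exact: le_trans (gC w) (ltW Cx).
have := UV f; rewrite f1E f2E Uv => /(_ _ _ (bdd _ b) (bdd _ b1) (bdd _ b2)) H.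
have {H} := H (fun x => let: DeriveDef d _ := d1 x in d)
  (fun x => let: DeriveDef d _ := d2 x in d).
have cf : continuous f := is_derive_continuous d1.
have if0 : P.-integrable [set: T] (EFin \o (fun w => f (U w))).
  apply: (@probability_bounded_integrable _ _ _ _ _ C) => //.
  by apply: measurableT_comp => //; exact: continuous_measurable_fun.
have if2 : P.-integrable [set: T] (EFin \o (fun w => f2 (V w))).
  by apply: (@probability_bounded_integrable _ _ _ _ _ C) => //; exact: measurableT_comp.
have -> : 'E_P[f \o U] = (\int[P]_w f (U w))%R%:E.
  by rewrite unlock /Rintegral fineK//; exact: integrable_fin_num.
have -> : 'E_P[f2 \o V] = (\int[P]_w f2 (V w))%R%:E.
  by rewrite unlock /Rintegral fineK//; exact: integrable_fin_num.
rewrite -EFinB -!EFinM => -[] /eqP; rewrite subr_eq => /eqP ->.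
by rewrite addrC [(2^-1 * v)%R]mulrC.
Qed.

(** Conditioning on [S = y] leaves [E f(y + U)], to which the equilibrium
property applies through the translate of [f] by [y]. *)
Lemma equilibrium_independent_sum (S U V : {RV P >-> R}) (v : R) f f1 f2 C :
  indep_classes P (g_sigma_algebra_preimage S) (g_sigma_algebra_preimage U) ->
  indep_classes P (g_sigma_algebra_preimage S) (g_sigma_algebra_preimage V) ->
  centered_equilibrium U V -> 'E_P[fun w => (U w ^+ 2)%R] = v%:E ->
  test_function f f1 f2 C ->
  (\int[P]_w f (S w + U w) =
   \int[P]_w f (S w) + v / 2 * \int[P]_w f2 (S w + V w))%R.
Proof.
move=> SU SV UV Uv tf; have [d1 d2 mf2 b b1 b2] := tf.
have mf := continuous_measurable_fun (is_derive_continuous d1).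
have mD (g : R -> R) : measurable_fun [set: R] g ->
    measurable_fun [set: R * R] (fun z => g (z.1 + z.2)%R).
  move=> mg; apply: measurableT_comp => //.
  by apply: measurable_funD; [exact: measurable_fst|exact: measurable_snd].
rewrite (bounded_indep_fubini SU (mD _ mf) (fun z => b _)).
rewrite (bounded_indep_fubini SV (mD _ mf2) (fun z => b2 _)) /=.
have i1 : P.-integrable [set: T] (EFin \o (fun w => f (S w))).
  by apply: (@probability_bounded_integrable _ _ _ _ _ C) => //; exact: measurableT_comp.
have i2 : P.-integrable [set: T] (EFin \o (fun w => \int[P]_v f2 (S w + V v))%R).
  apply: (@probability_bounded_integrable _ _ _ _ _ C).
    exact: (measurable_partial_expectation _ _ (mD _ mf2) (fun z => b2 _)).
  move=> w; apply: normr_expectation_le => //.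
  by apply: measurableT_comp => //; exact: measurable_funD.
rewrite -RintegralZl// -RintegralD//; last first.
  rewrite (_ : _ \o _ = (fun w => (v / 2)%:E * (\int[P]_v f2 (S w + V v))%R%:E))//.
  exact: integrableZl.
apply: eq_Rintegral => w _.
by rewrite (equilibrium_test_function UV Uv (test_function_shift (S w) tf)) addr0.
Qed.

End independent_expectations.

(** * Moments of sums of independent centered variables *)

Section second_moments.
Context d (T : measurableType d) (R : realType) (P : probability T R).

Lemma square_integrable (Y : {RV P >-> R}) (b : R) :
  \int[P]_w (Y w ^+ 2)%:E = b%:E ->
  P.-integrable [set: T] (EFin \o (fun w => Y w ^+ 2)%R).
Proof.
move=> Yb; apply/integrableP; split.
  by apply/measurable_EFinP; exact: measurable_funX.
under eq_integral do rewrite /= ger0_norm ?sqr_ge0//.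
by rewrite Yb ltry.
Qed.

Lemma square_integrable_mul (S Y : {RV P >-> R}) (a b : R) :
  \int[P]_w (S w ^+ 2)%:E = a%:E -> \int[P]_w (Y w ^+ 2)%:E = b%:E ->
  P.-integrable [set: T] (EFin \o (fun w => S w * Y w)%R).
Proof.
move=> /square_integrable iS /square_integrable iY.
apply: (@le_integrable _ _ _ _ _ _ _ (EFin \o (fun w => S w ^+ 2 + Y w ^+ 2)%R)) => //.
- by apply/measurable_EFinP; exact: measurable_funM.
- move=> w _; rewrite /= lee_fin [leRHS]ger0_norm ?addr_ge0 ?sqr_ge0//.
  by rewrite ler_norml; apply/andP; split; nra.
- rewrite (_ : _ \o _ = (EFin \o (fun w => S w ^+ 2)%R) \+ (EFin \o (fun w => Y w ^+ 2)%R))//.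
  exact: integrableD.
Qed.

Lemma indep_second_moment (S Y : {RV P >-> R}) (a b : R) :
  indep_classes P (g_sigma_algebra_preimage S) (g_sigma_algebra_preimage Y) ->
  \int[P]_w (S w ^+ 2)%:E = a%:E -> \int[P]_w (Y w ^+ 2)%:E = b%:E ->
  \int[P]_w (Y w)%:E = 0 ->
  \int[P]_w ((S w + Y w) ^+ 2)%:E = (a + b)%:E.
Proof.
move=> indSY Sa Yb Y0.
have iS := square_integrable Sa.
have iY := square_integrable Yb.
have iSY := square_integrable_mul Sa Yb.
have iY1 : P.-integrable [set: T] (EFin \o Y).
  have i1 : \int[P]_w ((cst 1 w : R) ^+ 2)%:E = 1%:E.
    under eq_integral do rewrite expr1n.
    by rewrite integral_cst// mul1e; exact: probability_setT.
  have := square_integrable_mul (S := cst 1%R) i1 Yb.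
  by congr (integrable _ _ _); apply/funext => w /=; rewrite mul1r.
have SY0 : \int[P]_w (S w * Y w)%:E = 0.
  rewrite (indep_fubini indSY (f := fun z => (z.1 * z.2)%:E)) //=.
  - under eq_integral => w _.
      rewrite (_ : \int[P]_v _ = 0); last first.
        by under eq_integral do rewrite EFinM; rewrite integralZl// Y0 mule0.
      over.
    exact: integral0.
  - apply/measurable_EFinP; apply: measurable_funM; first exact: measurable_fst.
    exact: measurable_snd.
transitivity (\int[P]_w ((S w ^+ 2)%:E + ((Y w ^+ 2)%:E + (2 * (S w * Y w))%:E))).
  by apply: eq_integral => w _; rewrite -!EFinD; congr EFin; ring.
have i2 : P.-integrable [set: T] (fun w => (2 * (S w * Y w))%:E).
  rewrite (_ : (fun w => _) = (fun w => 2%:E * (S w * Y w)%:E))//.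
  exact: integrableZl.
rewrite integralD//; last exact: integrableD.
rewrite integralD// Sa Yb; under eq_integral do rewrite EFinM.
by rewrite integralZl// SY0 mule0 adde0.
Qed.

(** By the arithmetic-geometric mean inequality, [|y| <= y^2 / (2 t) + t / 2];
both terms have mean [t / 2]. *)
Lemma first_moment_le (Y : {RV P >-> R}) (t : R) : (0 < t)%R ->
  \int[P]_w (Y w ^+ 2)%:E = (t ^+ 2)%:E -> \int[P]_w `|Y w|%:E <= t%:E.
Proof.
move=> t0 Yt.
have iY := square_integrable Yt.
apply: (@le_trans _ _ (\int[P]_w ((Y w ^+ 2)%:E * (2 * t)^-1%:E + (t / 2)%:E))).
  apply: ge0_le_integral => //.
  - by apply/measurable_EFinP; exact: measurableT_comp.
  - apply: emeasurable_funD; last exact: measurable_cst.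
    apply: emeasurable_funM; last exact: measurable_cst.
    by apply/measurable_EFinP; exact: measurable_funX.
  - move=> w _; rewrite -EFinM -EFinD lee_fin -(@ler_pM2r _ (2 * t)) ?mulr_gt0//.
    rewrite [leRHS](_ : _ = Y w ^+ 2 + t ^+ 2)%R; last by field; rewrite gt_eqF.
    have := sqr_ge0 (`|Y w| - t)%R; have := real_normK (num_real (Y w)); nra.
rewrite integralD//.
- rewrite integralZr// Yt integral_cst// [X in _ + _ * X](probability_setT P) mule1.
  by rewrite -EFinM -EFinD lee_fin le_eqVlt; apply/orP; left; apply/eqP; field; rewrite gt_eqF.
- exact: integrableZr.
- exact: probability_integrable_cst.
Qed.

End second_moments.

Section block_sums.
Context d (T : measurableType d) (R : realType) (P : probability T R).
Variable X : nat -> {RV P >-> R}.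

Definition block_sum (m n : nat) (w : T) : R := (\sum_(m.+1 <= i < n.+1) X i w)%R.

Lemma block_sum_id m w : block_sum m m w = 0%R.
Proof. by rewrite /block_sum big_geq. Qed.

Lemma block_sum_recr m n w : (m <= n)%N ->
  block_sum m n.+1 w = (block_sum m n w + X n.+1 w)%R.
Proof. by move=> mn; rewrite /block_sum big_nat_recr. Qed.

Lemma block_sum_cat m n w : (m <= n)%N ->
  block_sum 0 n w = (block_sum 0 m w + block_sum m n w)%R.
Proof. by move=> mn; rewrite /block_sum (@big_cat_nat _ _ _ m.+1). Qed.

Lemma measurable_block_sum (G : set (set T)) m n :
  (forall i, (m < i <= n)%N -> measurable_fun [set: g_sigma_algebraType G] (X i)) ->
  measurable_fun [set: g_sigma_algebraType G] (block_sum m n).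
Proof.
have zero : measurable_fun [set: g_sigma_algebraType G] (fun=> 0%R : R).
  exact: measurable_cst.
elim: n => [|n IH] mX.
  rewrite (_ : block_sum m 0 = fun=> 0%R)//.
  by apply/funext => w; rewrite /block_sum big_geq.
have [mn|nm] := leqP m n; last first.
  rewrite (_ : block_sum m n.+1 = fun=> 0%R)//.
  by apply/funext => w; rewrite /block_sum big_geq.
rewrite (_ : block_sum m n.+1 = fun w => block_sum m n w + X n.+1 w)%R; last first.
  by apply/funext => w; rewrite block_sum_recr.
apply: measurable_funD.
  by apply: IH => i /andP[mi i_n]; apply: mX; rewrite mi leqW.
by apply: mX; rewrite ltnS mn leqnn.
Qed.

Let measurable_block_sumT m n : measurable_fun [set: T] (block_sum m n).
Proof. exact: (measurable_sum _ (fun i => measurable_funP (X i))). Qed.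

HB.instance Definition _ m n :=
  isMeasurableFun.Build _ _ _ _ (block_sum m n) (measurable_block_sumT m n).

Variable s : nat -> R.
Hypothesis X_indep : mutually_independent P [set i | (0 < i)%N] (fun i => X i : T -> R).
Hypothesis X_mean : forall i, (0 < i)%N -> 'E_P[X i] = 0.
Hypothesis X_var : forall i, (0 < i)%N ->
  'E_P[fun w => (X i w ^+ 2)%R] = (s i ^+ 2)%:E.
Hypothesis s_pos : forall i, (0 < i)%N -> (0 < s i)%R.

Lemma indep_block_sum m n :
  indep_classes P (g_sigma_algebra_preimage (block_sum m n))
                  (g_sigma_algebra_preimage (X n.+1)).
Proof.
apply: indep_classes_sym.
have mX i : measurable_fun [set: T] (X i : T -> R) by exact: measurable_funP.
have := mutually_independent_sigma_family mX X_indep (ltn0Sn n).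
apply: sub_indep_classes => //; apply: sub_sigma_family.
apply: measurable_block_sum => i /andP[mi i_n].
apply: (sigma_family_measurable (D := [set k | (0 < k)%N /\ k <> n.+1])
  (X := fun i => X i : T -> R)).
split; first exact: leq_ltn_trans mi.
by move=> iE; move: i_n; rewrite iE ltnn.
Qed.

Lemma block_sum_second_moment m n : (m <= n)%N ->
  \int[P]_w (block_sum m n w ^+ 2)%:E = (\sum_(m.+1 <= i < n.+1) s i ^+ 2)%R%:E.
Proof.
elim: n => [|n IH] mn.
  move: mn; rewrite leqn0 => /eqP ->; rewrite big_geq//.
  under eq_integral do rewrite block_sum_id expr0n.
  exact: integral0.
have [mn'|nm] := leqP m n; last first.
  have -> : m = n.+1 by apply/eqP; rewrite eqn_leq mn nm.
  rewrite big_geq//; under eq_integral do rewrite block_sum_id expr0n.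
  exact: integral0.
rewrite big_nat_recr//=; under eq_integral do rewrite block_sum_recr//.
apply: (indep_second_moment (@indep_block_sum m n)); first exact: IH.
  by rewrite -X_var// unlock.
by rewrite -(X_mean (ltn0Sn n)) unlock.
Qed.

(** The supremum may be infinite, which makes the bound trivial unless [m = n],
and then both sides vanish. *)
Lemma block_sum_first_moment m n : (m <= n)%N ->
  \int[P]_w `|block_sum m n w|%:E <=
  ereal_sup [set (s i)%:E | i in [set i | (0 < i)%N]] *
    (Num.sqrt `|n%:R - m%:R|)%:E.
Proof.
move=> mn; set E := ereal_sup _.
have sE i : (0 < i)%N -> (s i)%:E <= E.
  by move=> i0; apply: ereal_sup_ubound; exists i.
have E0 : 0 < E by apply: lt_le_trans (sE 1%N isT); rewrite lte_fin s_pos.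
have [nm|mn'] := eqVneq m n.
  under eq_integral do rewrite nm block_sum_id normr0.
  by rewrite integral0 nm subrr normr0 sqrtr0 mule0.
have {}mn' : (m < n)%N by rewrite ltn_neqAle mn' mn.
have nm0 : (0 < n%:R - m%:R :> R)%R by rewrite subr_gt0 ltr_nat.
rewrite gtr0_norm//.
case: E E0 sE => [r|_ _|]; last by [].
- rewrite lte_fin => r0 sE.
  pose v := (\sum_(m.+1 <= i < n.+1) s i ^+ 2)%R.
  have v0 : (0 < v)%R.
    rewrite /v big_ltn ?ltnS//; apply: ltr_pwDl; first by rewrite exprn_gt0// s_pos.
    by apply: sumr_ge0 => i _; exact: sqr_ge0.
  have vle : (v <= r ^+ 2 * (n%:R - m%:R))%R.
    rewrite -natrB// mulr_natr -(subSS m n) -sumr_const_nat.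
    apply: ler_sum_nat => i /andP[mi _].
    have i0 : (0 < i)%N by exact: leq_trans mi.
    have := sE i i0; rewrite lee_fin => sir.
    by apply: lerXn2r => //; rewrite nnegrE ltW// s_pos.
  have sv0 : (0 < Num.sqrt v)%R by rewrite sqrtr_gt0.
  apply: (@le_trans _ _ (Num.sqrt v)%:E).
    apply: (@first_moment_le _ _ _ P (block_sum m n)) => //.
    by rewrite sqr_sqrtr ?ltW//; exact: block_sum_second_moment.
  rewrite -EFinM lee_fin -[X in (_ <= X * _)%R](ger0_norm (ltW r0)) -sqrtr_sqr.
  by rewrite -sqrtrM ?sqr_ge0// ler_sqrt// mulr_ge0 ?sqr_ge0// ltW.
- by rewrite gt0_mulye ?leey// lte_fin sqrtr_gt0.
Qed.

End block_sums.

(** * The size-biased index *)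

Section size_biased_index.
Context d (T : measurableType d) (R : realType) (P : probability T R).
Variables (N M : {RV P >-> nat}) (sigma : R) (s : nat -> R).
Hypothesis sigma_pos : (0 < sigma)%R.
Hypothesis M_pos : forall w, (0 < M w)%N.
Hypothesis M_law : forall m, (0 < m)%N ->
  P [set w | M w = m] = (s m ^+ 2 / sigma ^+ 2)%:E * P [set w | (m <= N w)%N].

(** Tonelli on both sides: the [i]-th terms are [s_i^2 e_i P(N >= i)] and
[sigma^2 e_i P(M = i)]. *)
Lemma ge0_size_biased (e : nat -> R) : (forall i, 0 <= e i)%R ->
  \int[P]_w (\sum_(1 <= i < (N w).+1) s i ^+ 2 * e i)%R%:E =
  (sigma ^+ 2)%:E * \int[P]_w (e (M w))%:E.
Proof.
move=> e0.
have mN (B : set nat) : measurable (N @^-1` B) by exact: measurable_funPTI.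
have mM (B : set nat) : measurable (M @^-1` B) by exact: measurable_funPTI.
have t0 i : (0 <= s i ^+ 2 * e i)%R by rewrite mulr_ge0 ?sqr_ge0.
pose A i := [set w | (0 < i <= N w)%N].
have mA i : measurable (A i) by exact: (mN [set n | (0 < i <= n)%N]).
pose B i := [set w | M w = i].
have mB i : measurable (B i) by exact: (mM [set i]).
have NE w : (\sum_(1 <= i < (N w).+1) s i ^+ 2 * e i)%R%:E =
    \sum_(0 <= i <oo) (s i ^+ 2 * e i)%:E * (\1_(A i) w)%:E.
  rewrite (nneseries_split 0 (N w).+1); last first.
    by move=> i _; rewrite mule_ge0 ?lee_fin ?indicE.
  rewrite add0n [X in _ + X]eseries0 ?adde0; last first.
    move=> i /= Ni _; rewrite indicE memNset ?mule0//=.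
    by apply/negP; rewrite negb_and -!ltnNge Ni orbT.
  rewrite [RHS]big_ltn// indicE memNset//= mule0 add0e -sumEFin.
  apply: eq_big_nat => i /andP[i0 iN].
  by rewrite indicE mem_set ?mule1// /A/= i0.
have ME w : (e (M w))%:E = \sum_(0 <= i <oo) (e i)%:E * (\1_(B i) w)%:E.
  rewrite (nneseries_split 0 (M w).+1); last first.
    by move=> i _; rewrite mule_ge0 ?lee_fin ?indicE.
  rewrite add0n [X in _ + X]eseries0 ?adde0; last first.
    move=> i /= Mi _; rewrite indicE memNset ?mule0//=.
    by move=> Mwi; move: Mi; rewrite Mwi ltnn.
  rewrite big_nat_recr//= big1_seq ?add0e; first by rewrite indicE mem_set ?mule1.
  move=> i /=; rewrite mem_index_iota => /andP[_ iM]; rewrite indicE memNset ?mule0//=.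
  by move=> Mwi; move: iM; rewrite Mwi ltnn.
under eq_integral do rewrite NE; under [in RHS]eq_integral do rewrite ME.
have mI (C : set T) (c : R) : measurable C ->
    measurable_fun [set: T] (fun w => c%:E * (\1_C w)%:E).
  move=> mC; apply: emeasurable_funM; first exact: measurable_cst.
  by apply/measurable_EFinP; exact: measurable_indic.
rewrite integral_nneseries//; [|by move=> i; exact: mI|]; last first.
  by move=> i w _; rewrite mule_ge0 ?lee_fin ?indicE.
rewrite integral_nneseries//; [|by move=> i; exact: mI|]; last first.
  by move=> i w _; rewrite mule_ge0 ?lee_fin ?indicE.
rewrite -nneseriesZl//; last first.
  by move=> i _; apply: integral_ge0 => w _; rewrite mule_ge0 ?lee_fin ?indicE.
apply: eq_eseriesr => i _.
have int1 (C : set T) (c : R) : measurable C -> (0 <= c)%R ->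
    \int[P]_w (c%:E * (\1_C w)%:E) = c%:E * P C.
  move=> mC c0; rewrite ge0_integralZl//.
  - by rewrite integral_indic// setIT.
  - by apply/measurable_EFinP; exact: measurable_indic.
rewrite !int1//.
(* The index 0 carries no mass on either side. *)
have [->|i0] := posnP i.
  rewrite (_ : A 0%N = set0); last by apply/seteqP; split.
  rewrite (_ : B 0%N = set0); last first.
    by apply/seteqP; split => // w /= Mw; have := M_pos w; rewrite Mw.
  by rewrite measure0 !mule0.
rewrite M_law// (_ : A i = [set w | (i <= N w)%N]); last first.
  by apply/seteqP; split => w; rewrite /A/= i0.
rewrite !muleA -!EFinM; congr (_%:E * _).
by field; rewrite gt_eqF.
Qed.

(** The case [e = 1], since [M] has total mass one. *)
Lemma size_biased_variance :
  \int[P]_w (\sum_(1 <= i < (N w).+1) s i ^+ 2)%R%:E = (sigma ^+ 2)%:E.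
Proof.
have := @ge0_size_biased (fun=> 1%R) (fun=> ler01).
rewrite integral_cst// [X in _ = _ * (_ * X)](probability_setT P) !mule1 => <-.
apply: eq_integral => w _; congr (_%:E).
by apply: eq_bigr => i _; rewrite mulr1.
Qed.

(** Apply the nonnegative case to [e + C] and subtract; [size_biased_variance]
provides the integrability that makes the subtraction legitimate. *)
Lemma size_biased (e : nat -> R) (C : R) : (forall i, `|e i| <= C)%R ->
  (\int[P]_w (\sum_(1 <= i < (N w).+1) s i ^+ 2 * e i) =
   sigma ^+ 2 * \int[P]_w e (M w))%R.
Proof.
move=> eC.
have mN (g : nat -> R) := measurable_fun_nat_comp N g.
have mM (g : nat -> R) := measurable_fun_nat_comp M g.
have iV : P.-integrable [set: T]
    (EFin \o (fun w => \sum_(1 <= i < (N w).+1) s i ^+ 2)%R).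
  apply/integrableP; split.
    exact/measurable_EFinP/(mN (fun n => \sum_(1 <= i < n.+1) s i ^+ 2)%R).
  under eq_integral.
    move=> w _; rewrite /= ger0_norm; last by apply: sumr_ge0 => i _; exact: sqr_ge0.
    over.
  by rewrite size_biased_variance ltry.
have iCV := integrableZl measurableT C iV.
have iW : P.-integrable [set: T]
    (EFin \o (fun w => \sum_(1 <= i < (N w).+1) s i ^+ 2 * e i)%R).
  apply: le_integrable iCV => //.
    exact/measurable_EFinP/(mN (fun n => \sum_(1 <= i < n.+1) s i ^+ 2 * e i)%R).
  move=> w _; rewrite /= lee_fin normrM [X in (_ <= _ * X)%R]ger0_norm; last first.
    by apply: sumr_ge0 => i _; exact: sqr_ge0.
  rewrite mulr_sumr; apply: le_trans (ler_norm_sum _ _ _) _.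
  apply: ler_sum => i _; rewrite normrM ger0_norm ?sqr_ge0// mulrC.
  by rewrite ler_wpM2r ?sqr_ge0// (le_trans (eC i))// ler_norm.
have ie : P.-integrable [set: T] (EFin \o (fun w => e (M w))).
  exact: (@probability_bounded_integrable _ _ _ _ _ C).
have eC0 i : (0 <= e i + C)%R.
  by rewrite -lerBlDr sub0r; have := eC i; rewrite ler_norml => /andP[].
have Pc := Rintegral_probability_cst P C.
have H : (\int[P]_w (\sum_(1 <= i < (N w).+1) s i ^+ 2 * (e i + C)) =
   sigma ^+ 2 * \int[P]_w (e (M w) + C))%R.
  rewrite {1}/Rintegral ge0_size_biased// fineM//.
  apply: integrable_fin_num => //.
  apply: (@probability_bounded_integrable _ _ _ _ _ (C + `|C|)%R).
    exact: (mM (fun m => e m + C)%R).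
  by move=> w; apply: le_trans (ler_normD _ _) _; rewrite lerD.
move: H; rewrite RintegralD//; last exact: probability_integrable_cst.
rewrite Pc mulrDr.
under eq_Rintegral => w _.
  rewrite (_ : (\sum_(1 <= i < (N w).+1) s i ^+ 2 * (e i + C) =
    \sum_(1 <= i < (N w).+1) s i ^+ 2 * e i +
      C * \sum_(1 <= i < (N w).+1) s i ^+ 2)%R); last first.
    by rewrite mulr_sumr -big_split/=; apply: eq_bigr => i _; ring.
  over.
rewrite RintegralD// RintegralZl//.
rewrite [X in (_ + C * X)%R]/Rintegral size_biased_variance/= [X in (_ = _ + X)%R]mulrC.
exact: addIr.
Qed.

End size_biased_index.

(** * The equilibrium identity for random sums *)

Definition rv_of d d' (T : measurableType d) (S : measurableType d') (g : T -> S)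
    (mg : measurable_fun [set: T] g) : {mfun T >-> S} :=
  HB.pack g (isMeasurableFun.Build _ _ _ _ g mg).

Section random_sum_equilibrium.
Context d (T : measurableType d) (R : realType) (P : probability T R).
Variables (N M : {RV P >-> nat}) (X XL : nat -> {RV P >-> R}).
Variables (sigma : R) (s : nat -> R).
Hypothesis X_indep : mutually_independent P [set i | (0 < i)%N] (fun i => X i : T -> R).
Hypothesis X_mean : forall i, (0 < i)%N -> 'E_P[X i] = 0.
Hypothesis s_pos : forall i, (0 < i)%N -> (0 < s i)%R.
Hypothesis X_var : forall i, (0 < i)%N ->
  'E_P[fun w => (X i w ^+ 2)%R] = (s i ^+ 2)%:E.
Hypothesis sigma_pos : (0 < sigma)%R.
Hypothesis M_pos : forall w, (0 < M w)%N.
Hypothesis M_law : forall m, (0 < m)%N ->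
  P [set w | M w = m] = (s m ^+ 2 / sigma ^+ 2)%:E * P [set w | (m <= N w)%N].
Hypothesis XL_equilibrium :
  forall m, (0 < m)%N -> centered_equilibrium (X m) (XL m).
Hypothesis XL_X_indep : forall m, (0 < m)%N ->
  indep_classes P (g_sigma_algebra_preimage (XL m))
    (sigma_family [set k | (0 < k)%N /\ k <> m] (fun k => X k : T -> R)).
Hypothesis NM_XXL_indep : indep_classes P
  (g_sigma_algebra_preimage (fun w => (N w, M w)))
  (sigma_family [set i | (0 < i)%N] (fun i w => (X i w, XL i w))).

Let NM w := (N w, M w).

Let measurable_NM : measurable_fun [set: T] NM.
Proof. exact: measurable_fun_pair. Qed.

HB.instance Definition _ := isMeasurableFun.Build _ _ _ _ NM measurable_NM.

Let pairs := \bigcup_(i in [set i | (0 < i)%N])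
  g_sigma_algebra_preimage (fun w => (X i w, XL i w)).

Let pairs_pair i : (0 < i)%N ->
  measurable_fun [set: g_sigma_algebraType pairs] (fun w => (X i w, XL i w)).
Proof.
move=> i0; exact: (sigma_family_measurable (D := [set i | (0 < i)%N])
  (X := fun i w => (X i w, XL i w))).
Qed.

Let pairs_X i : (0 < i)%N -> measurable_fun [set: g_sigma_algebraType pairs] (X i).
Proof. by move=> i0; exact: measurableT_comp measurable_fst (pairs_pair i0). Qed.

Let pairs_XL i : (0 < i)%N -> measurable_fun [set: g_sigma_algebraType pairs] (XL i).
Proof. by move=> i0; exact: measurableT_comp measurable_snd (pairs_pair i0). Qed.

Let pairs_block m n : measurable_fun [set: g_sigma_algebraType pairs] (block_sum X m n).
Proof.
by apply: measurable_block_sum => i /andP[mi _]; apply: pairs_X; exact: leq_ltn_trans mi.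
Qed.

Let indep_NM d' (S : measurableType d') (Z : T -> S) :
  measurable_fun [set: g_sigma_algebraType pairs] Z ->
  indep_classes P (g_sigma_algebra_preimage NM) (g_sigma_algebra_preimage Z).
Proof.
move=> mZ; apply: sub_indep_classes NM_XXL_indep => //.
exact: (sub_sigma_family mZ).
Qed.

Let code (k : nat * nat) : nat := pickle k.

Let code_inj : injective code.
Proof. exact: (pcan_inj pickleK). Qed.

Let measurable_index (k : nat * nat) : measurable [set k].
Proof.
case: k => n m; rewrite (_ : [set (n, m)] = [set n] `*` [set m]).
  exact: measurableX.
by apply/seteqP; split => -[a b] /= => [[-> ->]|[-> ->]].
Qed.

(** For [m >= 1] this is [S_(m-1) + X_m^L]. *)
Definition equilibrium_sum (m : nat) (w : T) : R := (block_sum X 0 m.-1 w + XL m w)%R.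

Let measurable_equilibrium_sum m : measurable_fun [set: T] (equilibrium_sum m).
Proof. exact: measurable_funD. Qed.

HB.instance Definition _ m :=
  isMeasurableFun.Build _ _ _ _ (equilibrium_sum m) (measurable_equilibrium_sum m).

Lemma expectation_block_sumS n f f1 f2 C : test_function f f1 f2 C ->
  (\int[P]_w f (block_sum X 0 n.+1 w) =
   \int[P]_w f (block_sum X 0 n w) +
   s n.+1 ^+ 2 / 2 * \int[P]_w f2 (equilibrium_sum n.+1 w))%R.
Proof.
move=> tf; rewrite /equilibrium_sum/=.
rewrite -(equilibrium_independent_sum _ _ (XL_equilibrium (ltn0Sn n)) _ tf).
- by apply: eq_Rintegral => w _; rewrite block_sum_recr.
- exact: indep_block_sum.
- apply: indep_classes_sym.
  apply: sub_indep_classes (XL_X_indep (ltn0Sn n)) => //; apply: sub_sigma_family.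
  apply: measurable_block_sum => i /andP[i0 i_n].
  apply: (sigma_family_measurable (D := [set k | (0 < k)%N /\ k <> n.+1])
    (X := fun i => X i : T -> R)).
  by split => // iE; move: i_n; rewrite iE ltnn.
- exact: X_var.
Qed.

Lemma expectation_block_sum n f f1 f2 C : test_function f f1 f2 C ->
  (\int[P]_w f (block_sum X 0 n w) = f 0 + 2^-1 *
   \sum_(1 <= i < n.+1) s i ^+ 2 * \int[P]_w f2 (equilibrium_sum i w))%R.
Proof.
move=> tf; elim: n => [|n IH].
  rewrite big_geq// mulr0 addr0.
  under eq_Rintegral do rewrite block_sum_id.
  exact: Rintegral_probability_cst.
rewrite (expectation_block_sumS _ tf) IH [in RHS]big_nat_recr//= mulrDr addrA.
by congr (_ + _)%R; rewrite mulrA [X in (X * _)%R]mulrC.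
Qed.

(** The random sum telescopes into its increments, [size_biased] transfers the
weights from [N] to [M], and freezing moves expectations in and out of the
random indices. *)
Lemma random_sum_equilibrium f f1 f2 C : test_function f f1 f2 C ->
  (\int[P]_w f (random_sum X N w) =
   f 0 + sigma ^+ 2 / 2 * \int[P]_w f2 (equilibrium_sum (M w) w))%R.
Proof.
move=> tf; have [d1 d2 mf2 b b1 b2] := tf.
have mf := continuous_measurable_fun (is_derive_continuous d1).
pose e m := (\int[P]_w f2 (equilibrium_sum m w))%R.
have eC m : (`|e m| <= C)%R by apply: normr_expectation_le => //; exact: measurableT_comp.
have mE m : (0 < m)%N -> measurable_fun [set: g_sigma_algebraType pairs] (equilibrium_sum m).
  by move=> m0; apply: measurable_funD; [exact: pairs_block|exact: pairs_XL].
have mfS n : measurable_fun [set: T] (fun w => f (block_sum X 0 n w)).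
  exact: measurableT_comp.
have mf2E m : measurable_fun [set: T] (fun w => f2 (equilibrium_sum m.-1.+1 w)).
  exact: measurableT_comp.
pose Zf (k : nat * nat) : {RV P >-> R} := rv_of (mfS k.1).
(* [m.-1.+1] equals [m] at the values taken by [M], and keeps the index positive. *)
pose Ze (k : nat * nat) : {RV P >-> R} := rv_of (mf2E k.2).
have frf := bounded_freezing (K := NM) code_inj measurable_index (Z := Zf) (C := C)
  (fun k w => b _) (fun k => indep_NM (measurableT_comp mf (pairs_block 0 k.1))).
have fre := bounded_freezing (K := NM) code_inj measurable_index (Z := Ze) (C := C)
  (fun k w => b2 _) (fun k => indep_NM (measurableT_comp mf2 (mE k.2.-1.+1 isT))).
have -> : (\int[P]_w f2 (equilibrium_sum (M w) w) = \int[P]_w e (M w))%R.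
  transitivity (\int[P]_w Ze (NM w) w)%R.
    by apply: eq_Rintegral => w _; rewrite /Ze/= prednK.
  rewrite fre; apply: eq_Rintegral => w _; rewrite /e.
  by apply: eq_Rintegral => v _; rewrite /Ze/= prednK.
rewrite -mulrA mulrCA -(size_biased sigma_pos M_pos M_law eC).
pose a n := (\int[P]_w f (block_sum X 0 n w))%R.
(* The sum over the increments is bounded, being [2 * (a n - f 0)]. *)
have aC n : (`|a n| <= C)%R by apply: normr_expectation_le => //; exact: measurableT_comp.
have iaN : P.-integrable [set: T] (EFin \o (fun w => a (N w))).
  apply: (@probability_bounded_integrable _ _ _ _ _ C) => //.
  exact: measurable_fun_nat_comp.
have if0 := probability_integrable_cst P (f 0%R).
transitivity (\int[P]_w a (N w))%R; first exact: frf.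
under [X in (_ = _ + _ * X)%R]eq_Rintegral => w _.
  rewrite (_ : (\sum_(1 <= i < (N w).+1) s i ^+ 2 * e i = 2 * (a (N w) - f 0))%R); last first.
    by rewrite /a (expectation_block_sum _ tf) addrAC subrr add0r mulrA divff// mul1r.
  over.
rewrite RintegralZl//; last exact: (integrableB measurableT iaN if0).
rewrite RintegralB// [X in (_ - X)%R]Rintegral_probability_cst.
by rewrite mulrA mulVf// mul1r addrC subrK.
Qed.

Lemma measurable_select_index (Y : nat -> {RV P >-> R}) :
  measurable_fun [set: T] (fun w => Y (M w) w).
Proof.
apply: (measurable_fun_select (NM : {RV P >-> (nat * nat)%type}) code_inj measurable_index
  (g := fun k w => Y k.2 w)) => k; exact: measurable_funP.
Qed.

(** Freezing [(N, M)] leaves the first moment of the sum over the block of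
indices between [N] and [M], in either order. *)
Lemma random_sum_gap :
  \int[P]_w `|random_sum X N w - block_sum X 0 (M w) w|%:E <=
  ereal_sup [set (s i)%:E | i in [set i | (0 < i)%N]] *
    \int[P]_w (Num.sqrt `|(N w)%:R - (M w)%:R|)%:E.
Proof.
set E := ereal_sup _.
have E0 : 0 <= E.
  apply: (@le_trans _ _ (s 1%N)%:E); first by rewrite lee_fin ltW// s_pos.
  by apply: ereal_sup_ubound; exists 1%N.
pose gap (k : nat * nat) w := (`|block_sum X 0 k.1 w - block_sum X 0 k.2 w|)%R.
have mgap G k : (forall m n, measurable_fun [set: g_sigma_algebraType G] (block_sum X m n)) ->
    measurable_fun [set: g_sigma_algebraType G] (gap k).
  by move=> mG; apply: measurableT_comp => //; exact: measurable_funB.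
have mgapT k : measurable_fun [set: T] (gap k).
  by apply: measurableT_comp => //; exact: measurable_funB.
have fr := ge0_freezing (K := NM) code_inj measurable_index (Z := fun k => rv_of (mgapT k))
  (fun k w => normr_ge0 _) (fun k => indep_NM (mgap pairs k pairs_block)).
have mgNM : measurable_fun [set: T] (fun w => (Num.sqrt `|(N w)%:R - (M w)%:R|)%:E : \bar R).
  apply/measurable_EFinP.
  exact: (measurable_fun_select (NM : {RV P >-> (nat * nat)%type}) code_inj measurable_index
    (g := fun k _ => Num.sqrt `|k.1%:R - k.2%:R|%R : R)).
rewrite [leLHS]fr -ge0_integralZl//.
apply: ge0_le_integral => //.
- by move=> w _; apply: integral_ge0 => v _; rewrite lee_fin normr_ge0.
- exact: (measurable_fun_select (NM : {RV P >-> (nat * nat)%type}) code_inj measurable_index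
    (g := fun k _ => \int[P]_v (gap k v)%:E)).
- exact: measurable_funeM.
move=> w _ /=; rewrite /gap/=.
have [mn|/ltnW nm] := leqP (M w) (N w).
  under eq_integral do rewrite (block_sum_cat _ _ mn) addrAC subrr add0r.
  exact: (block_sum_first_moment X_indep X_mean X_var s_pos mn).
under eq_integral do rewrite distrC (block_sum_cat _ _ nm) addrAC subrr add0r.
rewrite distrC; exact: (block_sum_first_moment X_indep X_mean X_var s_pos nm).
Qed.

End random_sum_equilibrium.

(** * The bounded Lipschitz bound *)

(** With [m = sqrt mu] this feeds the normalised sum [S_N / m] into the Stein
solution.  The bound on the second derivative comes from the Stein equation
itself. *)
Lemma stein_test_function (R : realType) (b c m : R) (h g g1 g2 : R -> R) :
  (0 < b)%R -> (0 < m)%R -> H_BL h -> laplace_stein_solution b c h g g1 g2 ->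
  exists C, test_function (fun x => g (x / m))%R (fun x => g1 (x / m) / m)%R
    (fun x => g2 (x / m) / m ^+ 2)%R C.
Proof.
move=> b0 m0 [h1 hL] [d1 d2 _ gb g1b gE _].
have dl := is_derive_divr m.
have cg : continuous g := is_derive_continuous d1.
have g2E x : g2 x = ((g x - h x + c) / b ^+ 2)%R.
  have := gE x => /eqP; rewrite subr_eq => /eqP ->.
  rewrite addrAC [X in (_ / X)%R]expr2.
  by field; rewrite gt_eqF.
exists (2 + b^-1 / m + (2 + 1 + `|c|) / b ^+ 2 / m ^+ 2)%R.
have p1 : (0 <= b^-1 / m)%R by rewrite divr_ge0 ?invr_ge0 ?ltW.
have p2 : (0 <= (2 + 1 + `|c|) / b ^+ 2 / m ^+ 2)%R.
  by rewrite !divr_ge0 ?sqr_ge0// !addr_ge0.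
split.
- by move=> x; exact: (@is_derive1_comp R g (fun y => y / m)%R x _ _ (d1 _) (dl x)).
- move=> x; have := is_deriveZ m^-1%R
    (@is_derive1_comp R g1 (fun y => y / m)%R x _ _ (d2 _) (dl x)).
  rewrite (_ : (m^-1%R \*: (g1 \o (fun y => y / m)))%R =
      (fun y : R => g1 (y / m) / m)%R); last first.
    by apply/funext => y; rewrite [RHS]mulrC.
  by congr is_derive; rewrite /GRing.scale/=; field; rewrite gt_eqF.
- have mg2 : measurable_fun [set: R] g2.
    rewrite (_ : g2 = fun x => (g x - h x + c) / b ^+ 2)%R; last exact/funext.
    apply: measurable_funM => //; apply: measurable_funD => //; apply: measurable_funB.
      exact: continuous_measurable_fun.
    by apply: continuous_measurable_fun; exact: lipschitz_continuous.
  apply: measurable_funM => //; apply: measurableT_comp => //.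
  exact: measurable_funM.
- by move=> x; rewrite -addrA; apply: le_trans (gb _) _; rewrite lerDl addr_ge0.
- move=> x; apply: (@le_trans _ _ (b^-1 / m)%R).
    by rewrite normrM [X in (_ * X)%R]ger0_norm ?invr_ge0 ?(ltW m0)// ler_pM2r ?invr_gt0.
  by rewrite addrAC lerDr addr_ge0.
- move=> x; apply: (@le_trans _ _ ((2 + 1 + `|c|) / b ^+ 2 / m ^+ 2)%R); last first.
    by rewrite lerDr addr_ge0.
  rewrite normrM [X in (_ * X)%R]ger0_norm ?invr_ge0 ?sqr_ge0//.
  rewrite ler_pM2r ?invr_gt0 ?exprn_gt0// g2E.
  rewrite normrM [X in (_ * X)%R]ger0_norm ?invr_ge0 ?sqr_ge0//.
  rewrite ler_pM2r ?invr_gt0 ?exprn_gt0//.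
  apply: le_trans (ler_normD _ _) _; rewrite lerD2r.
  by apply: le_trans (ler_normB _ _) _; rewrite lerD.
Qed.

Theorem theorem4p3 (d : measure_display) (T : measurableType d) (R : realType)
  (P : probability T R)
  (N M : {RV P >-> nat}) (X XL : nat -> {RV P >-> R})
  (mu sigma : R) (s : nat -> R)
  (N_pos : forall w, (0 < N w)%N)
  (N_mean : 'E_P[fun w => (N w)%:R] = mu%:E)
  (X_indep : mutually_independent P [set i | (0 < i)%N] (fun i => X i : T -> R))
  (N_X_indep : indep_classes P (g_sigma_algebra_preimage N)
     (sigma_family [set i | (0 < i)%N] (fun i => X i : T -> R)))
  (X_mean : forall i, (0 < i)%N -> 'E_P[X i] = 0)
  (s_pos : forall i, (0 < i)%N -> (0 < s i)%R)
  (X_var : forall i, (0 < i)%N ->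
     'E_P[fun w => (X i w ^+ 2)%R] = (s i ^+ 2)%:E)
  (sigma_pos : (0 < sigma)%R)
  (sigma_def : (sigma ^+ 2)%:E = 'E_P[fun w => (random_sum X N w ^+ 2)%R])
  (M_pos : forall w, (0 < M w)%N)
  (NM_X_indep : indep_classes P
     (g_sigma_algebra_preimage (fun w => (N w, M w)))
     (sigma_family [set i | (0 < i)%N] (fun i => X i : T -> R)))
  (M_law : forall m, (0 < m)%N ->
     P [set w | M w = m] =
     (s m ^+ 2 / sigma ^+ 2)%:E * P [set w | (m <= N w)%N])
  (XL_equilibrium : forall m, (0 < m)%N -> centered_equilibrium (X m) (XL m))
  (XL_X_indep : forall m, (0 < m)%N ->
     indep_classes P (g_sigma_algebra_preimage (XL m))
       (sigma_family [set k | (0 < k)%N /\ k <> m] (fun k => X k : T -> R)))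
  (NM_XXL_indep : indep_classes P
     (g_sigma_algebra_preimage (fun w => (N w, M w)))
     (sigma_family [set i | (0 < i)%N] (fun i w => (X i w, XL i w)))) :
  'E_P[fun w => (\sum_(1 <= i < (N w).+1) s i ^+ 2)%R] = (sigma ^+ 2)%:E
  /\
  d_BL (distribution P ((Num.sqrt mu)^-1 \o* random_sum X N)%R)
       (laplace_prob (sigma / Num.sqrt (2 * mu)))
  <= ((Num.sqrt mu)^-1 + Num.sqrt 8 / sigma)%:E *
     ('E_P[fun w => `|X (M w) w - XL (M w) w|%R]
      + ereal_sup [set (s i)%:E | i in [set i | (0 < i)%N]]
        * 'E_P[fun w => Num.sqrt `|(N w)%:R - (M w)%:R|%R]).
Proof.
have mu_ge1 : (1 <= mu)%R.
  rewrite -lee_fin -N_mean unlock.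
  have -> : 1%:E = \int[P]_w (cst 1%:E w).
    by rewrite integral_cst// [X in _ * X](probability_setT P) mule1.
  apply: ge0_le_integral => //.
  - by apply/measurable_EFinP; exact: (measurable_fun_nat_comp N (fun n => n%:R : R)).
  - by move=> w _; rewrite lee_fin ler1n.
split.
  by rewrite unlock; exact: (size_biased_variance sigma_pos M_pos M_law).
have mu0 : (0 < mu)%R by exact: lt_le_trans mu_ge1.
pose m := Num.sqrt mu.
have m0 : (0 < m)%R by rewrite sqrtr_gt0.
have m2 : (m ^+ 2 = mu)%R by rewrite sqr_sqrtr// ltW.
pose b := (sigma / Num.sqrt (2 * mu))%R.
have s2m0 : (0 < Num.sqrt (2 * mu))%R by rewrite sqrtr_gt0 mulr_gt0.
have b0 : (0 < b)%R by rewrite divr_gt0.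
have b2 : (b ^+ 2 = sigma ^+ 2 / 2 / m ^+ 2)%R.
  rewrite /b expr_div_n sqr_sqrtr ?mulr_ge0 ?(ltW mu0)// m2.
  by field; rewrite gt_eqF.
(* [1 / (b * sqrt mu)] is [sqrt 2 / sigma], half of the allowed term. *)
have coef : ((1 + b^-1) / m <= m^-1 + Num.sqrt 8 / sigma)%R.
  rewrite mulrDl mul1r lerD2l.
  have -> : (b^-1 / m = Num.sqrt 2 / sigma)%R.
    rewrite /b sqrtrM// -/m; field.
    by rewrite !gt_eqF// sqrtr_gt0.
  by rewrite ler_pM2r ?invr_gt0// ler_sqrt// ler_nat.
pose A := \int[P]_w `|X (M w) w - XL (M w) w|%:E.
pose G := ereal_sup [set (s i)%:E | i in [set i | (0 < i)%N]] *
  \int[P]_w (Num.sqrt `|(N w)%:R - (M w)%:R|)%:E.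
rewrite unlock -/A -/G.
have mS : measurable_fun [set: T] (random_sum X N) by exact: measurable_funP.
have mXL (Y : nat -> {RV P >-> R}) := measurable_select_index N M Y.
have mSM : measurable_fun [set: T] (fun w => block_sum X 0 (M w) w).
  exact: (mXL (fun n => block_sum X 0 n)).
have mEM : measurable_fun [set: T] (fun w => equilibrium_sum X XL (M w) w).
  exact: (mXL (fun n => equilibrium_sum X XL n)).
have gapE : \int[P]_w `|random_sum X N w - equilibrium_sum X XL (M w) w|%:E <= A + G.
  apply: (@le_trans _ _ (\int[P]_w (`|X (M w) w - XL (M w) w|%:E +
      `|random_sum X N w - block_sum X 0 (M w) w|%:E))).
    apply: ge0_le_integral => //.
    - by apply/measurable_EFinP/measurableT_comp => //; exact: measurable_funB.
    - apply: emeasurable_funD; apply/measurable_EFinP/measurableT_comp => //.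
        by apply: measurable_funB; exact: mXL.
      exact: measurable_funB.
    move=> w _; rewrite -EFinD lee_fin; apply: le_trans (ler_normD _ _).
    rewrite /equilibrium_sum -[in X in (_ <= `|_ + (_ - X)|)%R](prednK (M_pos w)).
    rewrite block_sum_recr// (prednK (M_pos w)) le_eqVlt; apply/orP; left; apply/eqP.
    by congr (`|_|)%R; ring.
  rewrite ge0_integralD//; first last.
  - by apply/measurable_EFinP/measurableT_comp => //; exact: measurable_funB.
  - by apply/measurable_EFinP/measurableT_comp => //; apply: measurable_funB; exact: mXL.
  by rewrite leeD2l//; exact: (random_sum_gap X_indep X_mean s_pos X_var NM_XXL_indep).
apply: ge_ereal_sup => _ [h hBL <-].
have [c [g [g1 [g2 [sol ->]]]]] := laplace_stein_exists b0 hBL.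
have [C tf] := stein_test_function b0 m0 hBL sol.
have [_ _ mf2 fC _ f2C] := tf.
have mf := continuous_measurable_fun (is_derive_continuous (test_derive tf)).
have mh : measurable_fun [set: R] h.
  by apply: continuous_measurable_fun; apply: lipschitz_continuous; case: hBL.
pose phi x := (b ^+ 2 * g2 (x / m))%R.
have phiE x : phi x = (b ^+ 2 * m ^+ 2 * (g2 (x / m) / m ^+ 2))%R.
  by rewrite /phi; field; rewrite gt_eqF.
have mphi : measurable_fun [set: R] phi.
  rewrite (_ : phi = fun x => b ^+ 2 * m ^+ 2 * (g2 (x / m) / m ^+ 2))%R; last exact/funext.
  exact: measurable_funM.
have phiC x : (`|phi x| <= b ^+ 2 * m ^+ 2 * C)%R.
  have bm0 : (0 <= b ^+ 2 * m ^+ 2)%R by rewrite mulr_ge0 ?sqr_ge0.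
  by rewrite phiE normrM (ger0_norm bm0); apply: ler_wpM2l.
have igS : P.-integrable [set: T] (EFin \o (fun w => g (random_sum X N w / m)%R)).
  apply: (@probability_bounded_integrable _ _ _ _ _ C) => [|w]; last exact: fC.
  exact: measurableT_comp mf mS.
have ipS : P.-integrable [set: T] (EFin \o (fun w => phi (random_sum X N w))).
  apply: (@probability_bounded_integrable _ _ _ _ _ (b ^+ 2 * m ^+ 2 * C)) => //.
  exact: measurableT_comp mphi mS.
have ipE : P.-integrable [set: T] (EFin \o (fun w => phi (equilibrium_sum X XL (M w) w))).
  apply: (@probability_bounded_integrable _ _ _ _ _ (b ^+ 2 * m ^+ 2 * C)) => //.
  exact: measurableT_comp mphi mEM.
have ifE : P.-integrable [set: T]
    (EFin \o (fun w => g2 (equilibrium_sum X XL (M w) w / m) / m ^+ 2)%R).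
  apply: (@probability_bounded_integrable _ _ _ _ _ C) => //.
  exact: measurableT_comp mf2 mEM.
have ih : P.-integrable [set: T] (EFin \o (fun w => h (random_sum X N w / m)%R)).
  apply: (@probability_bounded_integrable _ _ _ _ _ 1%R) => [|w]; last by case: hBL.
  have mSm : measurable_fun [set: T] (fun w => random_sum X N w / m)%R.
    exact: measurable_funM.
  exact: measurableT_comp mh mSm.
have equilibrium : (\int[P]_w g (random_sum X N w / m) =
    \int[P]_w phi (equilibrium_sum X XL (M w) w))%R.
  rewrite (random_sum_equilibrium X_indep X_var sigma_pos M_pos M_law
    XL_equilibrium XL_X_indep NM_XXL_indep tf).
  rewrite mul0r (stein_at0 sol) add0r.
  under [RHS]eq_Rintegral do rewrite phiE.
  by rewrite RintegralZl//; congr (_ * _)%R; rewrite b2; field; rewrite gt_eqF.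
have -> : \int[distribution P ((Num.sqrt mu)^-1 \o* random_sum X N)%R]_x (h x)%:E - c%:E =
    (\int[P]_w (phi (equilibrium_sum X XL (M w) w) - phi (random_sum X N w)))%R%:E.
  rewrite integral_distributionT; last exact/measurable_EFinP.
  rewrite RintegralB// -equilibrium -RintegralB//.
  have -> : (\int[P]_w (g (random_sum X N w / m) - phi (random_sum X N w)) =
      \int[P]_w (h (random_sum X N w / m) - c))%R.
    by apply: eq_Rintegral => w _; rewrite /phi (stein_eq sol).
  have ic := probability_integrable_cst P c.
  rewrite RintegralB// Rintegral_probability_cst EFinB.
  by rewrite /Rintegral fineK//; exact: integrable_fin_num.
have iD : P.-integrable [set: T] (EFin \o (fun w =>
    phi (equilibrium_sum X XL (M w) w) - phi (random_sum X N w))%R).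
  exact: (integrableB measurableT ipE ipS).
rewrite abse_EFin EFin_normr_Rintegral//.
have K10 : (0 <= (1 + b^-1) / m)%R.
  by rewrite divr_ge0 ?(ltW m0)// addr_ge0// invr_ge0 ltW.
have AG0 : 0 <= A + G by apply: le_trans gapE; apply: integral_ge0 => w _; rewrite lee_fin.
apply: (@le_trans _ _ (((1 + b^-1) / m)%:E * (A + G))); last first.
  by apply: lee_wpmul2r => //; rewrite lee_fin.
apply: le_trans; last by apply: lee_wpmul2l gapE; rewrite lee_fin.
have mD : measurable_fun [set: T]
    (fun w => `|random_sum X N w - equilibrium_sum X XL (M w) w|%:E).
  by apply/measurable_EFinP/measurableT_comp => //; exact: measurable_funB.
rewrite -ge0_integralZl//.
apply: le_trans; first by apply: le_abse_integral => //; case/integrableP: iD.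
apply: ge0_le_integral => //.
- by have /integrableP[+ _] := integrable_abse iD; exact.
- exact: measurable_funeM.
move=> w _; rewrite /= -EFinM lee_fin; apply: le_trans (stein_lipschitz sol _ _) _.
rewrite -mulrBl normrM [X in (_ * (_ * X))%R]ger0_norm ?invr_ge0 ?(ltW m0)// distrC.
by rewrite [X in (_ * X <= _)%R]mulrC mulrA.
Qed.
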